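(* Let $t\in[0,1)$ and let $X$ be any Fréchet space in $\{\ell(p+),\,ces(p+),\,d(p+):1\le p<\infty\}$. (i) The generalized Cesàro operator $C_t\in\mathcal{L}(X)$ is compact. (ii) The spectra of $C_t$ are given by $\sigma_{pt}(C_t;X)=\Lambda$ and $\sigma^*(C_t;X)=\sigma(C_t;X)=\Lambda\cup\{0\}$. (iii) For each $\lambda\in\sigma_{pt}(C_t;X)$ the subspace $(\lambda I-C_t)(X)$ is closed in $X$ with $\mathrm{codim}\,(\lambda I-C_t)(X)=1$. Moreover, for each $m\in\mathbb{N}_0$, the eigenspace $\mathrm{Ker}\left(\frac{1}{m+1}I-C_t\right)$ is $1$-dimensional and equals $\mathrm{span}(x^{[m]})$, with $x^{[m]}\in d_1\subseteq X$.
   Context: $\mathbb{N}_0=\{0,1,2,\dots\}$ and $\omega:=\mathbb{C}^{\mathbb{N}_0}$ with the topology of coordinatewise convergence. For $t\in[0,1]$, $C_tx:=\left(\frac{t^nx_0+t^{n-1}x_1+\dots+x_n}{n+1}\right)_{n\in\mathbb{N}_0}$ for $x\in\omega$ (with $0^0:=1$); $C_t$ acts on a sequence space $X\subseteq\omega$ by restriction. $\Lambda:=\{\frac{1}{n+1}:n\in\mathbb{N}_0\}$. Banach spaces: $\ell^q=\ell^q(\mathbb{N}_0)$ with its usual norm $\|\cdot\|_q$, $1\le q<\infty$; $ces(q):=\{x\in\omega: C_1|x|\in\ell^q\}$ with norm $\|x\|_{ces(q)}:=\|C_1|x|\,\|_q$, $1<q<\infty$, where $|x|=(|x_n|)_n$;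 $d_q:=\{x\in\ell^\infty:\hat x\in\ell^q\}$ with norm $\|x\|_{d_q}:=\|\hat x\|_q$, $1\le q<\infty$, where $\hat x:=(\sup_{k\ge n}|x_k|)_{n\in\mathbb{N}_0}$. Fréchet spaces: for $1\le p<\infty$ fix a strictly decreasing sequence $(p_k)_{k\in\mathbb{N}}\subseteq(p,\infty)$ with $p_k\downarrow p$. Then $\ell(p+):=\bigcap_k\ell^{p_k}$, $ces(p+):=\bigcap_k ces(p_k)$, $d(p+):=\bigcap_k d_{p_k}$, with the Fréchet topology generated by the norms $\|\cdot\|_{p_k}$, resp. $\|\cdot\|_{ces(p_k)}$, resp. $\|\cdot\|_{d_{p_k}}$, $k\in\mathbb{N}$ (independent of the choice of $(p_k)$). For $m\in\mathbb{N}$ define $x^{[m]}:=\alpha_m\left(0,\dots,0,1,\frac{(m+1)!}{m!\,1!}t,\frac{(m+2)!}{m!\,2!}t^2,\frac{(m+3)!}{m!\,3!}t^3,\dots\right)$ with $\alpha_m\in\mathbb{C}\setminus\{0\}$ arbitrary, where $1$ is in position $m$ (positions start at $0$), and $x^{[0]}:=\alpha_0(t^n)_{n\in\mathbb{N}_0}$ with $\alpha_0\in\mathbb{C}\setminus\{0\}$ arbitrary. For a locally convex Hausdorff space $X$, $\mathcal{L}(X)$ is the space of continuous linear operators on $X$. $T:X\to X$ linear is compact if there is a neighbourhood $\mathcal{U}$ of $0$ with $T(\mathcal{U})$ relatively compact in $X$. For $T\in\mathcal{L}(X)$: $\rho(T;X)$ is the set of $\lambda\in\mathbb{C}$ such that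 $R(\lambda,T):=(\lambda I-T)^{-1}$ exists in $\mathcal{L}(X)$; $\sigma(T;X):=\mathbb{C}\setminus\rho(T;X)$; $\sigma_{pt}(T;X)$ is the set of $\lambda$ such that $\lambda I-T$ is not injective; $\rho^*(T;X)$ is the set of $\lambda$ for which there is $\delta>0$ such that the open disc $B(\lambda,\delta)\subseteq\rho(T;X)$ and $\{R(\mu,T):\mu\in B(\lambda,\delta)\}$ is equicontinuous in $\mathcal{L}(X)$; $\sigma^*(T;X):=\mathbb{C}\setminus\rho^*(T;X)$. *)

(* Defs.v *)
From HB Require Import structures.
From mathcomp Require Import all_boot all_order all_algebra complex.
From mathcomp Require Import all_classical all_reals all_analysis.

Set Implicit Arguments.
Unset Strict Implicit.
Unset Printing Implicit Defensive.

Import Order.TTheory GRing.Theory Num.Theory.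
Import numFieldNormedType.Exports.
Import ComplexField.Normc.

Local Open Scope classical_set_scope.
Local Open Scope ring_scope.
Local Open Scope complex_scope.

Section SequenceNorms.
Context {R : realType}.
Implicit Types (q : R) (u v : nat -> \bar R) (x y : nat -> R[i]).

Definition gcesaro (t : R[i]) x : nat -> R[i] :=
  fun n => (\sum_(i < n.+1) t ^+ (n - i) * x i) / n.+1%:R.

Definition seqabs x : nat -> \bar R := fun n => (normc (x n))%:E.

(* The norms below are extended-valued: the corresponding sequence space is the
   set of all sequences of finite norm. *)

Definition ell_norm q x : \bar R := ('N[counting]_(q%:E) [ seqabs x ])%E.

Definition ces_norm q x : \bar R := ell_norm q (gcesaro 1 (fun n => `|x n|)).

(* If x is unbounded then [esups (seqabs x)] is constantly +oo and so is the
   norm, hence membership in l^oo need not be required separately. *)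
Definition d_norm q x : \bar R :=
  ('N[counting]_(q%:E) [ esups (seqabs x) ])%E.

(* For n = m + j, 'C(n, m) = (m + j)! / (m! j!). *)
Definition eigenseq (t : R[i]) (m : nat) (a : R[i]) : nat -> R[i] :=
  fun n => if (n < m)%N then 0 else a * ('C(n, m)%:R * t ^+ (n - m)).

Local Notation lnorm q u := (Lnorm counting q%:E u).

Local Lemma lnormZ q (c : R) u : 0 < q -> 0 <= c ->
  lnorm q ((fun n => c%:E * u n)%E) = (c%:E * lnorm q u)%E.
Proof.
move=> q0 c0; rewrite !Lnorm_counting//.
under eq_eseriesr do rewrite abseM poweRM// gee0_abs//.
rewrite nneseriesZl; last by move=> *; exact: poweR_ge0.
rewrite poweRM; last 2 first.
- by rewrite lee_fin powR_ge0.
- by apply: nneseries_ge0 => *; exact: poweR_ge0.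
by rewrite -poweR_EFin -poweRrM divff ?gt_eqF// poweRe1.
Qed.

Local Lemma le_lnorm q u v : 0 < q -> (forall n, 0 <= u n)%E ->
  (forall n, u n <= v n)%E -> (lnorm q u <= lnorm q v)%E.
Proof.
move=> q0 u0 uv; rewrite !Lnorm_counting//.
have v0 n : (0 <= v n)%E by exact: le_trans (uv n).
have s0 w : (0 <= \sum_(k <oo) (`|w k| `^ q))%E.
  by apply: nneseries_ge0 => *; exact: poweR_ge0.
apply: gt0_ler_poweR; rewrite ?invr_ge0 ?(ltW q0) ?in_itv/= ?s0 ?leey//.
apply: lee_nneseries => n *; first exact: poweR_ge0.
apply: gt0_ler_poweR; rewrite ?(ltW q0) ?in_itv/= ?abse_ge0 ?leey//.
by rewrite !gee0_abs.
Qed.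

Local Lemma lnorm_pinfty q u n : 0 < q -> u n = +oo%E -> lnorm q u = +oo%E.
Proof.
move=> q0 un; rewrite Lnorm_counting// (@nneseries_pinfty _ _ xpredT n)//.
- by rewrite poweRyr// invr_neq0// gt_eqF.
- by move=> *; exact: poweR_ge0.
- by rewrite un gee0_abs ?leey// poweRyr// gt_eqF.
Qed.

Local Lemma le_lnormD q u v : 1 <= q -> (forall n, 0 <= u n)%E ->
  (forall n, 0 <= v n)%E ->
  (lnorm q ((fun n => u n + v n)%E) <= lnorm q u + lnorm q v)%E.
Proof.
move=> q1 u0 v0; have q0 : 0 < q by exact: lt_le_trans q1.
have Ny w : lnorm q w != -oo%E by rewrite -ltNye (lt_le_trans _ (Lnorm_ge0 _ _ _)).
have [[n un]|/forallNP uf] := pselect (exists n, u n = +oo%E).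
  by rewrite [X in (_ <= X + _)%E](lnorm_pinfty q0 un) addye ?leey.
have [[n vn]|/forallNP vf] := pselect (exists n, v n = +oo%E).
  by rewrite [X in (_ <= _ + X)%E](lnorm_pinfty q0 vn) addey ?leey.
have fK (w : nat -> \bar R) : (forall n, 0 <= w n)%E -> (forall n, w n <> +oo%E) ->
    w = EFin \o (fine \o w).
  move=> w0 wf; apply/funext => n /=; rewrite fineK//  ge0_fin_numE//.
  by rewrite ltey; apply/eqP.
have := @minkowski_EFin _ nat R counting (fine \o u) (fine \o v) q.
rewrite (fK _ u0 uf) (fK _ v0 vf) => /(_ _ _ q1); apply; exact: measurableT_comp.
Qed.

Let lt01 q (q1 : 1 <= q) : 0 < q. Proof. exact: lt_le_trans q1. Qed.

Local Lemma normcE (a : R[i]) : `|a| = (normc a)%:C. Proof. by case: a. Qed.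

Local Lemma normcR (c : R) : normc c%:C = `|c|.
Proof. by rewrite /= expr0n addr0 sqrtr_sqr. Qed.

Local Lemma normc_ge0 (a : R[i]) : 0 <= normc a.
Proof. by rewrite -ler0c -normcE. Qed.

Local Lemma le_normcD (a b : R[i]) : normc (a + b) <= normc a + normc b.
Proof. by rewrite -lecR rmorphD/= -!normcE ler_normD. Qed.

Local Lemma seqabs_ge0 x n : (0 <= seqabs x n)%E.
Proof. by rewrite lee_fin normc_ge0. Qed.

Lemma ell_norm_ge0 q x : (0 <= ell_norm q x)%E. Proof. exact: Lnorm_ge0. Qed.

Lemma ell_normD q x y : 1 <= q ->
  (ell_norm q (x + y)%R <= ell_norm q x + ell_norm q y)%E.
Proof.
move=> q1; apply: le_trans _ (le_lnormD q1 (seqabs_ge0 x) (seqabs_ge0 y)).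
apply: le_lnorm (lt01 q1) (seqabs_ge0 _) _ => n.
by rewrite -EFinD lee_fin le_normcD.
Qed.

Lemma ell_normZ q (a : R[i]) x : 1 <= q ->
  ell_norm q (a *: x) = ((normc a)%:E * ell_norm q x)%E.
Proof.
move=> q1; rewrite /ell_norm -(lnormZ _ (lt01 q1) (normc_ge0 a)).
by congr Lnorm; apply/funext => n; rewrite /seqabs /= -EFinM normcM.
Qed.

Lemma ces_norm_ge0 q x : (0 <= ces_norm q x)%E. Proof. exact: Lnorm_ge0. Qed.

Local Lemma le_ell_norm q x y : 0 < q -> (forall n, `|x n| <= `|y n|) ->
  (ell_norm q x <= ell_norm q y)%E.
Proof.
move=> q0 xy; apply: le_lnorm q0 (seqabs_ge0 _) _ => n.
by rewrite lee_fin -lecR -!normcE.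
Qed.

Lemma ces_normD q x y : 1 <= q ->
  (ces_norm q (x + y)%R <= ces_norm q x + ces_norm q y)%E.
Proof.
move=> q1; apply: le_trans _ (ell_normD _ _ q1).
apply: le_ell_norm (lt01 q1) _ => n.
have E (z : nat -> R[i]) : gcesaro 1 z n = (\sum_(i < n.+1) z i) / n.+1%:R.
  by congr (_ / _); apply: eq_bigr => i _; rewrite expr1n mul1r.
rewrite -[X in _ <= `|X|]/(gcesaro 1 _ n + gcesaro 1 _ n) !E -mulrDl -big_split /=.
rewrite !ger0_norm ?divr_ge0 ?sumr_ge0// => *; rewrite ?addr_ge0//.
by rewrite ler_wpM2r ?invr_ge0// ler_sum// => i _; exact: ler_normD.
Qed.

Lemma ces_normZ q (a : R[i]) x : 1 <= q ->
  ces_norm q (a *: x) = ((normc a)%:E * ces_norm q x)%E.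
Proof.
move=> q1; have -> : normc a = normc (normc a)%:C 
  by rewrite normcR ger0_norm ?normc_ge0.
rewrite /ces_norm -(ell_normZ _ _ q1) -normcE; congr ell_norm; apply/funext => n.
rewrite /gcesaro /= [RHS]mulrA mulr_sumr; congr (_ / _); apply: eq_bigr => i _.
by rewrite mulrCA normrM.
Qed.

Lemma d_norm_ge0 q x : (0 <= d_norm q x)%E. Proof. exact: Lnorm_ge0. Qed.

Local Lemma esups_seqabs_ge0 x n : (0 <= esups (seqabs x) n)%E.
Proof.
apply: le_trans (seqabs_ge0 x n) _ => /=.
by apply: ereal_sup_ubound; exists n => /=.
Qed.

Lemma d_normD q x y : 1 <= q ->
  (d_norm q (x + y)%R <= d_norm q x + d_norm q y)%E.
Proof.
move=> q1.
apply: le_trans _ (le_lnormD q1 (esups_seqabs_ge0 x) (esups_seqabs_ge0 y)).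
apply: le_lnorm (lt01 q1) (esups_seqabs_ge0 _) _ => n.
apply: ge_ereal_sup => _ [k /= nk <-].
rewrite (@le_trans _ _ (seqabs x k + seqabs y k)%E)//.
  by rewrite -EFinD lee_fin le_normcD.
by apply: leeD; apply: ereal_sup_ubound; exists k.
Qed.

Lemma d_normZ q (a : R[i]) x : 1 <= q ->
  d_norm q (a *: x) = ((normc a)%:E * d_norm q x)%E.
Proof.
move=> q1; rewrite /d_norm -(lnormZ _ (lt01 q1) (normc_ge0 a)).
congr Lnorm; apply/funext => n; rewrite /esups /=.
rewrite -ereal_supZl ?normc_ge0//; last first.
  by apply/set0P; exists (seqabs x n); exists n => /=.
congr ereal_sup; apply/seteqP; split => [_ [k nk <-]|_ [_ [k nk <-] <-]].
  by exists (seqabs x k); [exists k|rewrite /seqabs normcM EFinM].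
by exists k => //; rewrite /seqabs normcM EFinM.
Qed.

End SequenceNorms.

Record eseminorm (R : realType) := ESeminorm {
  esn :> (nat -> R[i]) -> \bar R ;
  esn_ge0 : forall x, (0 <= esn x)%E ;
  esnD : forall x y, (esn (x + y)%R <= esn x + esn y)%E ;
  esnZ : forall a x, esn (a *: x) = ((normc a)%:E * esn x)%E }.

Section FiniteSeminorms.
Context {R : realType} (q : nat -> eseminorm R).
Local Notation C := R[i].

Definition finite_esn : {pred (nat -> C)} :=
  fun x => `[< forall k, (q k x < +oo)%E >].

(* The sequences on which all the q k are finite, with the locally convex
   topology generated by the q k. *)
Record fspace := FSpace { fseq : nat -> C; _ : finite_esn fseq }.

HB.instance Definition _ := [isSub for fseq].
HB.instance Definition _ := [Choice of fspace by <:].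

Local Lemma esn0 k : q k 0 = 0%E.
Proof. by rewrite -(scale0r (0 : nat -> C)) esnZ normc0 mul0e. Qed.

Local Lemma finite_esn_submod : submod_closed finite_esn.
Proof.
split; first by apply/asboolP => k; rewrite esn0 ltry.
move=> a x y /asboolP xf /asboolP yf; apply/asboolP => k.
apply: le_lt_trans (esnD _ _ _) _; rewrite esnZ lte_add_pinfty//.
rewrite lte_mul_pinfty ?lee_fin//.
by rewrite normc_ge0.
Qed.

HB.instance Definition _ := GRing.isSubmodClosed.Build C (nat -> C)
  finite_esn finite_esn_submod.
HB.instance Definition _ := [SubChoice_isSubLmodule of fspace by <:].

Implicit Types (x y z : fspace) (j k : nat) (e d : R).

Definition fsn k x : R := fine (q k (\val x)).

Lemma fsnE k x : (fsn k x)%:E = q k (\val x).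
Proof.
rewrite fineK// ge0_fin_numE ?esn_ge0//.
by have /asboolP := valP x; exact.
Qed.

Lemma fsn_ge0 k x : 0 <= fsn k x.
Proof. by rewrite -lee_fin fsnE esn_ge0. Qed.

Lemma fsnD k x y : fsn k (x + y) <= fsn k x + fsn k y.
Proof. by rewrite -lee_fin EFinD !fsnE; exact: esnD. Qed.

Lemma fsnZ k (a : C) x : fsn k (a *: x) = normc a * fsn k x.
Proof. by apply: EFin_inj; rewrite EFinM !fsnE; exact: esnZ. Qed.

Lemma fsn0 k : fsn k 0 = 0.
Proof. by apply: EFin_inj; rewrite fsnE; exact: esn0. Qed.

Definition fball x (ke : nat * R) : set fspace :=
  [set y | forall j, (j <= ke.1)%N -> fsn j (y - x) < ke.2].

Definition fnbhs x : set_system fspace :=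
  filter_from [set ke : nat * R | 0 < ke.2] (fball x).

HB.instance Definition _ := hasNbhs.Build fspace fnbhs.

Local Lemma fballxx x k e : 0 < e -> fball x (k, e) x.
Proof. by move=> e0 j _; rewrite subrr fsn0. Qed.

Local Lemma fball_triangle x y z k e d :
  fball x (k, e) y -> fball y (k, d) z -> fball x (k, e + d) z.
Proof.
move=> xy yz j jk; rewrite -(subrKA y) addrC.
apply: le_lt_trans (fsnD _ _ _) _.
by apply: ltrD; [exact: xy|exact: yz].
Qed.

Local Lemma fball_le x k l e d : (l <= k)%N -> e <= d ->
  fball x (k, e) `<=` fball x (l, d).
Proof.
move=> lk ed y xy j jl; apply: lt_le_trans ed.
exact: xy (leq_trans jl lk).
Qed.

Local Lemma fnbhs_filter x : ProperFilter (nbhs x).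
Proof.
apply: filter_from_proper; last by move=> [k e] e0; exists x; exact: fballxx.
apply: filter_from_filter; first by exists (0%N, 1) => /=.
move=> [k e] [l d] /= e0 d0; exists (maxn k l, Num.min e d) => /=.
  by rewrite lt_min e0.
by move=> y xy; split; apply: fball_le xy; rewrite ?leq_maxl ?leq_maxr ?ge_min ?lexx ?orbT.
Qed.

Local Lemma fnbhs_singleton x (A : set fspace) : nbhs x A -> A x.
Proof. by move=> [[k e] /= e0]; apply; exact: fballxx. Qed.

Local Lemma fnbhs_nbhs x (A : set fspace) : nbhs x A -> nbhs x (nbhs^~ A).
Proof.
move=> [[k e] /= e0 kA]; exists (k, e / 2) => /=; first by rewrite divr_gt0.
move=> y xy; exists (k, e / 2) => /=; first by rewrite divr_gt0.
move=> z yz; apply: kA; rewrite [e]splitr.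
exact: fball_triangle yz.
Qed.

HB.instance Definition _ := Nbhs_isNbhsTopological.Build fspace
  fnbhs_filter fnbhs_singleton fnbhs_nbhs.

Local Lemma fspace_add_continuous :
  continuous (fun z : fspace * fspace => z.1 + z.2).
Proof.
move=> [x y] A [[k e] /= e0 kA].
exists (fball x (k, e / 2), fball y (k, e / 2)).
  by split; exists (k, e / 2) => //=; rewrite divr_gt0.
move=> [x' y'] /= [xx yy]; apply: kA => j jk /=.
rewrite opprD addrACA [ltRHS]splitr.
apply: le_lt_trans (fsnD _ _ _) _.
by apply: ltrD; [exact: xx|exact: yy].
Qed.

Local Lemma fspace_scale_continuous :
  continuous (fun z : C^o * fspace => z.1 *: z.2).
Proof.
move=> [a x] A [[k e] /= e0 kA].
pose M := \sum_(j < k.+1) fsn j x + 1.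
have M0 : 0 < M by rewrite ltr_wpDl// sumr_ge0// => *; exact: fsn_ge0.
pose d := Num.min 1 (e / 2 / M).
have d0 : 0 < d by rewrite lt_min ltr01 !divr_gt0.
pose N := normc a + 1.
have N0 : 0 < N by rewrite ltr_wpDl// normc_ge0.
exists (ball (a : C^o) d%:C, fball x (k, e / 2 / N)).
  split; first by apply: nbhsx_ballx; rewrite -(rmorph0 (real_complex R)) ltcR.
  by exists (k, e / 2 / N) => //=; rewrite !divr_gt0.
move=> [b y] /= []; rewrite -ball_normE /= => ab xy; apply: kA => j jk /=.
have -> : b *: y - a *: x = b *: (y - x) + (b - a) *: x.
  by rewrite scalerBr scalerBl addrA subrK.
have {}ab : normc (b - a) < d by rewrite -ltcR -normcE distrC.
rewrite [ltRHS]splitr; apply: le_lt_trans (fsnD _ _ _) _; rewrite !fsnZ.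
apply: ltr_leD.
  have bN : normc b <= N.
    rewrite -(subrK a b) addrC (le_trans (le_normcD _ _))// lerD2l.
    by rewrite (le_trans (ltW ab))// ge_min lexx.
  rewrite (@le_lt_trans _ _ (N * fsn j (y - x)))//.
    by rewrite ler_wpM2r ?fsn_ge0.
  by rewrite mulrC -ltr_pdivlMr//; exact: xy.
rewrite (@le_trans _ _ (e / 2 / M * M))//; last by rewrite divfK// gt_eqF.
apply: ler_pM; rewrite ?normc_ge0 ?fsn_ge0//.
  by rewrite (le_trans (ltW ab))// ge_min lexx orbT.
rewrite /M (bigD1 (Ordinal (jk : (j < k.+1)%N)))//= -addrA lerDl.
by rewrite addr_ge0// sumr_ge0// => *; exact: fsn_ge0.
Qed.

Local Lemma fball_open x k e : open (fball x (k, e)).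
Proof.
rewrite openE => y xy.
have [d d0 xyd] : exists2 d, 0 < d &
    forall j, (j <= k)%N -> fsn j (y - x) + d <= e.
  elim: k xy => [|k ih] xy.
    exists (e - fsn 0 (y - x)); first by rewrite subr_gt0; exact: xy.
    by move=> j; rewrite leqn0 => /eqP ->; rewrite addrC subrK.
  have [|d d0 H] := ih; first by move=> j jk; exact: xy (leqW jk).
  exists (Num.min d (e - fsn k.+1 (y - x))).
    by rewrite lt_min d0 subr_gt0; exact: xy.
  move=> j; rewrite leq_eqVlt => /predU1P[->|jk].
    by rewrite -lerBrDl ge_min lexx orbT.
  by rewrite (le_trans _ (H j jk))// lerD2l ge_min lexx.
exists (k, d) => //= z yz j jk /=; rewrite -(subrKA y) addrC.
apply: le_lt_trans (fsnD _ _ _) _; apply: lt_le_trans (xyd _ jk).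
by rewrite ltrD2l; exact: yz.
Qed.

Local Lemma fball_convex x k e : convex_set (fball x (k, e)).
Proof.
apply/convex_setW => y z; rewrite !inE => xy xz l l0 l1; rewrite inE => j jk /=.
have [r r01 lr] : exists2 r, 0 < r < 1 & l%:num = r%:C.
  move: l0 l1; case: (l%:num) => r s; rewrite !ltcE /= => /andP[/eqP -> r0].
  by move=> /andP[_ r1]; exists r; rewrite ?r0.
have /andP[r0 r1] := r01.
rewrite [X in fsn _ X](_ : _ = r%:C *: (y - x) + (1 - r)%:C *: (z - x)).
  apply: le_lt_trans (fsnD _ _ _) _; rewrite !fsnZ !normcR.
  rewrite gtr0_norm// gtr0_norm ?subr_gt0//.
  rewrite (_ : e = r * e + (1 - r) * e); last first.
    by rewrite -mulrDl addrC subrK mul1r.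
  by apply: ltrD; rewrite ltr_pM2l ?subr_gt0//; [exact: xy|exact: xz].
rewrite !scalerBr addrACA -opprD -scalerDl -rmorphD/= (addrC r) subrK scale1r.
by congr (_ - _); rewrite /conv /= lr rmorphB rmorph1.
Qed.

Local Lemma fspace_locally_convex : exists2 B : set_system fspace,
  (forall b, b \in B -> convex_set b) & basis B.
Proof.
exists [set b | exists x ke, b = fball x ke].
  by move=> b; rewrite inE => -[x [[k e] ->]]; exact: fball_convex.
split; first by move=> b [x [[k e] ->]]; exact: fball_open.
move=> x A [[k e] /= e0 kA]; exists (fball x (k, e)) => //; split.
  by exists x, (k, e).
exact: fballxx.
Qed.

HB.instance Definition _ := PreTopologicalLmod_isTvs.Build C fspace
  fspace_add_continuous fspace_scale_continuous fspace_locally_convex.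
(* The factory above only builds the uniform structure. *)
HB.instance Definition _ := PreTopologicalNmodule_isTopologicalNmodule.Build
  fspace fspace_add_continuous.
HB.instance Definition _ := TopologicalNmodule_isTopologicalLmodule.Build
  C fspace fspace_scale_continuous.
HB.instance Definition _ :=
  Uniform_isTvs.Build C fspace fspace_locally_convex.

End FiniteSeminorms.

Section Dimension.
Context {K : fieldType} {E : lmodType K}.
Implicit Types V : set E.

Definition linspan (x : E) : set E := [set a *: x | a in [set: K]].

Definition has_dim V n := exists e : 'I_n -> E, (forall i, V (e i)) /\
  forall x, V x -> exists! c : 'I_n -> K, x = \sum_i c i *: e i.

(* For a linear subspace V: the classes of the e i form a basis of E / V. *)
Definition has_codim V n := exists e : 'I_n -> E,
  forall x, exists! c : 'I_n -> K, V (x - \sum_i c i *: e i).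

End Dimension.

Section Spectra.
Context {K : numFieldType} {E : tvsType K}.
Implicit Types (T S : {linear E -> E}) (l m : K).

Definition compact_operator T :=
  exists2 U : set E, nbhs 0 U & precompact (T @` U).

Definition lambda_sub l T : E -> E := fun x => l *: x - T x.

Definition is_resolvent T l S :=
  [/\ continuous S, cancel (lambda_sub l T) S & cancel S (lambda_sub l T)].

Definition resolvent_set T : set K := [set l | exists S, is_resolvent T l S].

Definition spectrum T : set K := ~` resolvent_set T.

Definition point_spectrum T : set K := [set l | ~ injective (lambda_sub l T)].

(* [equicontinuous] is stated for pointed uniform spaces. *)
Definition pointed_tvs : puniformType :=
  HB.pack (E : Type) E (isPointed.Build E 0).

Definition star_resolvent_set T : set K :=
  [set l | exists2 d : K, 0 < d &
    [set m | `|m - l| < d] `<=` resolvent_set T /\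
    equicontinuous
      [set S | exists2 m, `|m - l| < d & is_resolvent T m S]
      (fun S : {linear E -> E} => (S : E -> E) : E -> pointed_tvs)].

Definition star_spectrum T : set K := ~` star_resolvent_set T.

End Spectra.

Section Frechet.
Context {R : realType}.

Variant frechet_kind := EllPlus | CesPlus | DPlus.

Definition scale_norm (s : frechet_kind) (q : R) : (nat -> R[i]) -> \bar R :=
  match s with
  | EllPlus => ell_norm q
  | CesPlus => ces_norm q
  | DPlus => d_norm q
  end.

Local Lemma scale_norm_ge0 s q x : (0 <= scale_norm s q x)%E.
Proof. by case: s; exact: Lnorm_ge0. Qed.

Local Lemma scale_normD s q (q1 : 1 <= q) x y :
  (scale_norm s q (x + y)%R <= scale_norm s q x + scale_norm s q y)%E.
Proof. by case: s; [exact: ell_normD|exact: ces_normD|exact: d_normD]. Qed.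

Local Lemma scale_normZ s q (q1 : 1 <= q) a x :
  scale_norm s q (a *: x) = ((normc a)%:E * scale_norm s q x)%E.
Proof. by case: s; [exact: ell_normZ|exact: ces_normZ|exact: d_normZ]. Qed.

Definition scale_esn s q (q1 : 1 <= q) : eseminorm R :=
  ESeminorm (scale_norm_ge0 s q) (scale_normD s q1) (scale_normZ s q1).

Record exponents (p : R) := Exponents {
  expo :> nat -> R ;
  expo_gt : forall k, p < expo k ;
  expo_decr : forall k, expo k.+1 < expo k ;
  expo_cvg : expo @ \oo --> p }.

(* p_k > p >= 1, so the condition q > 1 in the definition of ces(q) holds for
   every exponent that is used. *)
Definition frechet (s : frechet_kind) (p : R) (p1 : 1 <= p) (pk : exponents p) :
    tvsType R[i] :=
  fspace (fun k => scale_esn s (le_trans p1 (ltW (expo_gt pk k)))).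

End Frechet.

(* Main.v *)
(** A finite norm is a statement about majorants: with [majorizes s u x] meaning
    [|x_n| <= u_n], [(C_1 |x|)_n <= u_n] or [sup_(k >= n) |x_k| <= u_n], the norm of
    [x] is at most [M] iff some [u] with [majorizes s u x] has l^q norm at most [M].
    Majorants survive convolution with a geometric sequence [tau^n], [tau < 1], and
    this convolution is bounded on l^q; hence so is, on every step of the three
    scales, any operator dominated by it.

    Compactness: the unit ball of a single norm consists of sequences with a
    majorant [u <= 1], and [C_t] sends these to sequences with majorant
    [H_(n+1) / ((1 - t) (n+1))], which lies in l^q for every [q > 1].  The tails of
    such sequences are uniformly small, so Tychonoff's theorem applies.

    Spectrum: the triangular system [l x - C_t x = y] is a first order recursion for
    [S_n = sum_(i <= n) t^(n-i) x_i] with factors [l t / (l - 1/(n+1)) --> t], so its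
    solution operator is dominated by a geometric convolution, locally uniformly in
    [l].  At [l = 1/(m+1)] solvability is a single continuous linear condition on
    [y_0, ..., y_m].  Finally [0] is in the spectrum since [(1/(n+1))_n] is not in
    the range of [C_t]. *)

From HB Require Import structures.
From Pilot Require Import Defs.
From mathcomp Require Import all_boot all_order all_algebra complex.
From mathcomp Require Import all_classical all_reals all_analysis.
From mathcomp Require Import ring lra.

Set Implicit Arguments.
Unset Strict Implicit.
Unset Printing Implicit Defensive.

Import Order.TTheory GRing.Theory Num.Theory.
Import numFieldNormedType.Exports.
Import ComplexField.Normc.

Local Open Scope classical_set_scope.
Local Open Scope ring_scope.
Local Open Scope complex_scope.

Local Notation normc_ge0 := Pilot.Defs.normc_ge0.
Local Notation le_normcD := Pilot.Defs.le_normcD.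
Local Notation normcR := Pilot.Defs.normcR.

(** * Geometric convolutions and harmonic means *)

Section PowerSums.
Context {R : realType}.
Implicit Types (q tau M : R) (u v : nat -> R).

Lemma powR_convex q (l a b : R) : 1 <= q -> 0 <= l <= 1 -> 0 <= a -> 0 <= b ->
  ((1 - l) * a + l * b) `^ q <= (1 - l) * a `^ q + l * b `^ q.
Proof.
move=> q1 l01 a0 b0; pose w := Itv01 (andP l01).1 (andP l01).2.
rewrite addrC [leRHS]addrC; apply: (@convex_powR R q q1 w b a);
  by rewrite inE/= in_itv/= andbT.
Qed.

Definition gconv tau u n : R := \sum_(i < n.+1) tau ^+ (n - i) * u i.

Lemma gconv0 tau u : gconv tau u 0 = u 0%N.
Proof. by rewrite /gconv big_ord1 mul1r. Qed.

Lemma gconvS tau u n : gconv tau u n.+1 = u n.+1 + tau * gconv tau u n.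
Proof.
rewrite /gconv big_ord_recr /= subnn mul1r addrC mulr_sumr; congr (_ + _).
by apply: eq_bigr => i _; rewrite mulrA -exprS subSn // -ltnS.
Qed.

Lemma gconv_ge0 tau u n : 0 <= tau -> (forall i, 0 <= u i) ->
  0 <= gconv tau u n.
Proof. by move=> tau0 u0; apply: sumr_ge0 => i _; rewrite mulr_ge0 ?exprn_ge0. Qed.

Lemma le_gconv tau u v n : 0 <= tau -> (forall i, (i <= n)%N -> u i <= v i) ->
  gconv tau u n <= gconv tau v n.
Proof.
move=> tau0 uv; apply: ler_sum => i _.
by rewrite ler_wpM2l ?exprn_ge0 ?uv // -ltnS.
Qed.

Lemma gconvZ tau (c : R) u n : gconv tau (fun i => c * u i) n = c * gconv tau u n.
Proof. by rewrite /gconv mulr_sumr; apply: eq_bigr => i _; rewrite mulrCA. Qed.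

Lemma gconv_ge tau u n : 0 <= tau -> (forall i, 0 <= u i) -> u n <= gconv tau u n.
Proof.
by case: n => [|n] tau0 u0; rewrite ?gconv0 // gconvS lerDl mulr_ge0 ?gconv_ge0.
Qed.

Lemma gconv_cst_le tau (c : R) n : 0 <= tau < 1 -> 0 <= c ->
  gconv tau (fun=> c) n <= c / (1 - tau).
Proof.
move=> /andP[tau0 tau1] c0; have d0 : 0 < 1 - tau by rewrite subr_gt0.
elim: n => [|n ih]; rewrite ?gconv0 ?gconvS.
  by rewrite ler_pdivlMr // ler_piMr // gerBl.
rewrite (@le_trans _ _ (c + tau * (c / (1 - tau)))) ?lerD2l ?ler_wpM2l //.
by rewrite -subr_ge0 [X in 0 <= X](_ : _ = 0) //; field; rewrite gt_eqF.
Qed.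

(** Summation and [gconv tau] are the convolutions with the constant sequence 1 and with [tau^n],
    and convolutions commute. *)
Lemma sum_gconv tau u n :
  \sum_(i < n.+1) gconv tau u i = gconv tau (fun i => \sum_(j < i.+1) u j) n.
Proof.
elim: n => [|n ih]; first by rewrite big_ord1 !gconv0 big_ord1.
rewrite gconvS -ih big_ord_recl gconv0 [in RHS]big_ord_recl -addrA; congr (_ + _).
by rewrite mulr_sumr -big_split; apply: eq_bigr => i _; rewrite gconvS.
Qed.

(* By convexity of [x ^ q],
   [v_n^q <= (1 - tau) (u_n / (1 - tau))^q + tau v_(n-1)^q] for [v = gconv tau u]. *)
Lemma gconv_power_sum tau u q M : 1 <= q -> 0 <= tau < 1 -> 0 <= M ->
  (forall n, 0 <= u n) ->
  (forall N, \sum_(n < N) u n `^ q <= M `^ q) ->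
  forall N, \sum_(n < N) gconv tau u n `^ q <= ((1 - tau)^-1 * M) `^ q.
Proof.
move=> q1 /andP[tau0 tau1] M0 u0 uM; have d0 : 0 < 1 - tau by rewrite subr_gt0.
have q0 : 0 < q by exact: lt_le_trans q1.
pose c := (1 - tau)^-1; have c0 : 0 <= c by rewrite invr_ge0 ltW.
have l01 : 0 <= tau <= 1 by rewrite tau0 ltW.
have step N : \sum_(n < N.+1) gconv tau u n `^ q <=
    (1 - tau) * c `^ q * (\sum_(n < N.+1) u n `^ q) +
    tau * \sum_(n < N) gconv tau u n `^ q.
  rewrite big_ord_recl gconv0 [X in _ <= _ * X + _]big_ord_recl.
  rewrite (mulrDr _ (u ord0 `^ q)) -addrA; apply: lerD.
    have := @powR_convex q tau (c * u 0%N) 0 q1 l01 (mulr_ge0 c0 (u0 _)) (lexx _).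
    rewrite mulr0 addr0 powR0 ?gt_eqF // mulr0 addr0 /c mulVKf ?gt_eqF //.
    by rewrite powRM ?invr_ge0 ?(ltW d0) // mulrA.
  rewrite !mulr_sumr -big_split; apply: ler_sum => i _ /=.
  have := @powR_convex q tau (c * u i.+1) (gconv tau u i) q1 l01
     (mulr_ge0 c0 (u0 _)) (gconv_ge0 i tau0 u0).
  by rewrite powRM ?invr_ge0 ?(ltW d0) // !mulrA /c mulfV ?gt_eqF // mul1r gconvS.
(* The bound [X = (c * M)^q] is the fixed point of the recursion in [step]:
   [(1 - tau) X + tau X = X]. *)
elim=> [|N ih]; first by rewrite big_ord0 powR_ge0.
apply: le_trans (step N) _; rewrite powRM // -/c.
rewrite (_ : c `^ q * M `^ q = (1 - tau) * c `^ q * M `^ q + tau * (c `^ q * M `^ q)).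
  rewrite lerD // ?ler_wpM2l //; first by rewrite mulr_ge0 ?powR_ge0 ?ltW.
  by rewrite -powRM.
by ring.
Qed.

End PowerSums.

Section HarmonicMeans.
Context {R : realType}.

(** This is [C_1] of the sequence [1/(i+1)], hence its least majorant in the [ces] scale. It also
    dominates [1/(n+1)], so that one sequence serves all three scales. *)
Definition harmonic_mean (n : nat) : R := (\sum_(i < n.+1) i.+1%:R^-1) / n.+1%:R.

Lemma harmonic_mean_ge n : n.+1%:R^-1 <= harmonic_mean n.
Proof.
rewrite /harmonic_mean ler_peMl ?invr_ge0 // big_ord_recl invr1 lerDl.
by apply: sumr_ge0 => i _; rewrite invr_ge0.
Qed.

Lemma harmonic_mean_ge0 n : 0 <= harmonic_mean n.
Proof. by apply: le_trans (harmonic_mean_ge n); rewrite invr_ge0. Qed.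

(** This is [ln (1 + x) <= x] at [x = -1/(n+2)], where [1 + x = (n+1)/(n+2)]. *)
Lemma inv_le_ln_diff n : n.+2%:R^-1 <= ln n.+2%:R - ln n.+1%:R :> R.
Proof.
have := @le_ln1Dx R (- n.+2%:R^-1).
rewrite ltrN2 invf_lt1 // ltr1n => /(_ isT).
rewrite (_ : 1 + - _ = n.+1%:R / n.+2%:R); last first.
  by rewrite -[n.+1%:R](addrK 1) natr1 mulrBl divff ?mul1r ?pnatr_eq0.
by rewrite ln_div ?posrE // lerNr opprB.
Qed.

Lemma harmonic_sum_le n : \sum_(i < n.+1) i.+1%:R^-1 <= 1 + ln n.+1%:R :> R.
Proof.
elim: n => [|n ih]; first by rewrite big_ord1 ln1 addr0 invr1.
rewrite big_ord_recr /= (le_trans (lerD ih (lexx _))) // -addrA lerD2l.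
by rewrite -lerBrDl inv_le_ln_diff.
Qed.

(** The logarithm is traded for a small power: [ln y < y] at [y = (n+1)^e] gives
    [ln (n+1) <= (n+1)^e / e]. *)
Lemma harmonic_mean_le (e : R) : 0 < e -> forall n,
  harmonic_mean n <= (1 + e^-1) * n.+1%:R `^ (e - 1).
Proof.
move=> e0 n; rewrite /harmonic_mean powRB ?pnatr_eq0 ?implybT // powRr1 //.
rewrite mulrA ler_wpM2r ?invr_ge0 // (le_trans (harmonic_sum_le n)) //.
have n0 : (0 : R) < n.+1%:R by [].
have p0 : 0 < n.+1%:R `^ e by exact: powR_gt0.
have p1 : 1 <= n.+1%:R `^ e.
  by rewrite -[leLHS](powRr0 n.+1%:R) ler_powR ?ler1n // ltW.
rewrite mulrDl mul1r lerD // mulrC ler_pdivlMr // mulrC -ln_powR.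
exact: ltW (ln_sublinear p0).
Qed.

(* [n^(-a) - (n+1)^(-a) >= a (n+1)^(-a-1)] makes the sum telescope. *)
Lemma power_sum_le (a : R) : 0 < a -> forall N,
  \sum_(n < N) n.+1%:R `^ (- (a + 1)) <= 1 + a^-1.
Proof.
move=> a0; have H N : \sum_(n < N.+1) n.+1%:R `^ (- (a + 1)) <=
    1 + a^-1 * (1 - N.+1%:R `^ (- a)).
  elim: N => [|N ih]; first by rewrite big_ord1 !powR1 subrr mulr0 addr0.
  rewrite big_ord_recr /= (le_trans (lerD ih (lexx _))) // -addrA lerD2l.
  rewrite -lerBrDl -mulrBr.
  rewrite (_ : 1 - _ - _ = N.+1%:R `^ (- a) - N.+2%:R `^ (- a)); last by ring.
  rewrite ler_pdivlMl //.
  have n0 : (0 : R) < N.+1%:R by [].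
  rewrite opprD powRD ?pnatr_eq0 ?implybT // powR_inv1 //.
  rewrite [N.+1%:R `^ _]/powR pnatr_eq0 /=.
  (* So [(N+1)^(-a) = (N+2)^(-a) exp (a h)] with [h = ln (N+2) - ln (N+1) >= 1/(N+2)], and
     [exp z >= 1 + z] concludes. *)
  have -> : - a * ln N.+1%:R = - a * ln N.+2%:R + a * (ln N.+2%:R - ln N.+1%:R) :> R.
    by ring.
  rewrite expRD [N.+2%:R `^ _]/powR pnatr_eq0 /= lerBrDl.
  rewrite -[X in X + _]mulr1 mulrCA -mulrDr.
  rewrite ler_wpM2l ?expR_ge0 // (le_trans _ (expR_ge1Dx _)) // lerD2l.
  by rewrite ler_wpM2l ?(ltW a0) // inv_le_ln_diff.
case=> [|N]; first by rewrite big_ord0 addr_ge0 // invr_ge0 ltW.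
by rewrite (le_trans (H N)) // lerD2l ler_piMr ?invr_ge0 ?(ltW a0) // gerBl powR_ge0.
Qed.

End HarmonicMeans.

(** * Majorants *)

(** For [k = maxn N n] write [(k+1)^(d-1) = (k+1)^(-d) (k+1)^(2d-1)]. The first factor is at most
    [(N+1)^(-d)], which makes tails small; the second is at most [(n+1)^(2d-1)], still in l^q. *)
Lemma harmonic_mean_tail (R : realType) (q : R) : 1 < q ->
  exists (w : nat -> R) (B d : R), [/\ 0 < d, 0 <= B,
    (forall N n, harmonic_mean (maxn N n) <= N.+1%:R `^ (- d) * w n) &
    forall L, \sum_(n < L) w n `^ q <= B `^ q].
Proof.
move=> q1; have q0 : 0 < q by lra.
(* The thirds are chosen so that [(2d - 1) q = -(a + 1)], the exponent in [power_sum_le]. *)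
pose d := (1 - q^-1) / 3; pose a := (q - 1) / 3.
have d0 : 0 < d by rewrite divr_gt0 // subr_gt0 invf_lt1.
have a0 : 0 < a by rewrite divr_gt0 // subr_gt0.
have c0 : 0 <= 1 + d^-1 by rewrite addr_ge0 // invr_ge0 ltW.
exists (fun n => (1 + d^-1) * n.+1%:R `^ (2 * d - 1)).
exists ((1 + d^-1) * (1 + a^-1) `^ q^-1), d.
split => //; first by rewrite mulr_ge0 ?powR_ge0.
- move=> N n; apply: le_trans (harmonic_mean_le d0 _) _.
  rewrite mulrCA ler_wpM2l //.
  rewrite (_ : d - 1 = - d + (2 * d - 1)); last by ring.
  rewrite powRD ?pnatr_eq0 ?implybT //.
  have dq : 2 * d - 1 <= 0.
    have : 0 < q^-1 by rewrite invr_gt0.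
    rewrite /d; lra.
  have le_powN (x y e : R) : 0 < x -> x <= y -> e <= 0 -> y `^ e <= x `^ e.
    move=> x0 xy e0; have y0 := lt_le_trans x0 xy.
    rewrite -[e]opprK !(powRN _ (- e)) lef_pV2 ?posrE ?powR_gt0 //.
    by rewrite ge0_ler_powR ?nnegrE ?oppr_ge0 ?(ltW x0) ?(ltW y0).
  by apply: ler_pM; rewrite ?powR_ge0 ?le_powN ?oppr_le0 ?(ltW d0) //
    ler_nat ltnS ?leq_maxl ?leq_maxr.
- move=> L; under eq_bigr do rewrite powRM ?powR_ge0 // -powRrM.
  rewrite -mulr_sumr powRM ?powR_ge0 // ler_wpM2l ?powR_ge0 //.
  rewrite -powRrM mulVf ?gt_eqF // powRr1; last by rewrite addr_ge0 // invr_ge0 ltW.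
  rewrite (_ : (2 * d - 1) * q = - (a + 1)); first exact: power_sum_le.
  by rewrite /d /a; field; rewrite gt_eqF.
Qed.

Section ScaleNorms.
Context {R : realType}.
Implicit Types (q M tau : R) (u v : nat -> R) (x y : nat -> R[i]).

(** An infinite entry makes the norm infinite, so under a finite bound [fine \o v] is itself an
    admissible [u]. This reduces extended-valued norms to real partial sums. *)
Lemma Lnorm_counting_leP q M (v : nat -> \bar R) : 0 < q -> 0 <= M ->
  (forall n, 0 <= v n)%E ->
  ('N[counting]_(q%:E) [v] <= M%:E)%E <->
  exists u, (forall n, (v n <= (u n)%:E)%E) /\
    forall N, \sum_(n < N) u n `^ q <= M `^ q.
Proof.
move=> q0 M0 v0; have qV0 : 0 <= q^-1 by rewrite invr_ge0 ltW.
have s0 (w : nat -> \bar R) : (0 <= \sum_(k <oo) (`|w k| `^ q))%E.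
  by apply: nneseries_ge0 => *; exact: poweR_ge0.
split=> [vM|[u [vu uM]]].
  have vf n : v n \is a fin_num.
    rewrite ge0_fin_numE // ltey; apply/eqP => vn.
    by have := Pilot.Defs.lnorm_pinfty q0 vn; move: vM => /[swap] ->; rewrite leye_eq.
  exists (fine \o v); split=> [n|N] /=; first by rewrite fineK.
  have sM : (\sum_(k <oo) (`|v k| `^ q) <= (M `^ q)%:E)%E.
    rewrite -poweR_EFin -[leLHS]poweRe1 // -(mulVf (lt0r_neq0 q0)) poweRrM.
    rewrite -Lnorm_counting //.
    by apply: gt0_ler_poweR; rewrite ?(ltW q0) ?in_itv/= ?Lnorm_ge0 ?lee_fin ?leey ?andbT.
  rewrite -lee_fin; apply: le_trans sM.
  rewrite -sumEFin -(big_mkord xpredT (fun i => (fine (v i) `^ q)%:E)).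
  have -> : (\sum_(0 <= i < N) (fine (v i) `^ q)%:E =
             \sum_(0 <= i < N) (`|v i| `^ q))%E.
    by apply: eq_bigr => i _; rewrite -poweR_EFin fineK // gee0_abs.
  by apply: nneseries_lim_ge => *; exact: poweR_ge0.
have u0 n : 0 <= u n by rewrite -lee_fin (le_trans (v0 n)).
apply: le_trans (Pilot.Defs.le_lnorm q0 v0 vu) _.
rewrite Lnorm_counting //.
have -> : M%:E = ((M `^ q)%:E `^ q^-1)%E.
  by rewrite poweR_EFin -powRrM mulfV ?gt_eqF // powRr1.
apply: gt0_ler_poweR; rewrite ?in_itv/= ?s0 ?leey ?lee_fin ?powR_ge0 ?andbT //.
  by apply: nneseries_ge0 => *; rewrite lee_fin powR_ge0.
apply: lime_le.
  by apply: is_cvg_nneseries => *; rewrite lee_fin powR_ge0.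
apply: nearW => N; rewrite big_mkord sumEFin lee_fin.
by under eq_bigr do rewrite ger0_norm //.
Qed.

Definition majorizes (s : frechet_kind) u x : Prop :=
  match s with
  | EllPlus => forall n, normc (x n) <= u n
  | CesPlus => forall n, \sum_(i < n.+1) normc (x i) <= n.+1%:R * u n
  | DPlus => forall n k, (n <= k)%N -> normc (x k) <= u n
  end.

Lemma normcn n : normc (n%:R : R[i]) = n%:R.
Proof.
have -> : (n%:R : R[i]) = (n%:R)%:C by rewrite rmorph_nat.
by rewrite normcR ger0_norm.
Qed.

Lemma normc_gt0 (a : R[i]) : a != 0 -> 0 < normc a.
Proof.
by move=> a0; rewrite lt0r normc_ge0 andbT; apply: contra_neq a0; exact: eq0_normc.
Qed.

Lemma scale_norm_leP s q M x : 0 < q -> 0 <= M ->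
  (scale_norm s q x <= M%:E)%E <->
  exists u, majorizes s u x /\ forall N, \sum_(n < N) u n `^ q <= M `^ q.
Proof.
move=> q0 M0; case: s => /=.
- apply: iff_trans (Lnorm_counting_leP q0 M0 (Pilot.Defs.seqabs_ge0 x)) _.
  by split=> -[u [xu uM]]; exists u; split=> // n; have := xu n; rewrite lee_fin.
- apply: iff_trans (Lnorm_counting_leP q0 M0 (Pilot.Defs.seqabs_ge0 _)) _.
  have E n u : (seqabs (gcesaro 1 (fun n => `|x n|))%R n <= (u n)%:E)%E =
      (\sum_(i < n.+1) normc (x i) <= n.+1%:R * u n).
    rewrite lee_fin /gcesaro normcM normcV normcn ler_pdivrMr // mulrC.
    under eq_bigr do rewrite expr1n mul1r Pilot.Defs.normcE.
    rewrite -rmorph_sum normcR ger0_norm //.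
    by apply: sumr_ge0 => i _; exact: normc_ge0.
  by split=> -[u [xu uM]]; exists u; split=> // n; have := xu n; rewrite E.
- apply: iff_trans (Lnorm_counting_leP q0 M0 (Pilot.Defs.esups_seqabs_ge0 x)) _.
  split=> -[u [xu uM]]; exists u; split=> //.
    move=> n k nk; rewrite -lee_fin; apply: le_trans (xu n).
    by apply: ereal_sup_ubound; exists k.
  by move=> n; apply: ge_ereal_sup => _ [k /= nk <-]; rewrite lee_fin xu.
Qed.

Lemma scale_norm_lty s q x : 0 < q ->
  (scale_norm s q x < +oo)%E <->
  exists M, 0 <= M /\ (scale_norm s q x <= M%:E)%E.
Proof.
move=> q0; split=> [xf|[M [M0 xM]]]; last exact: le_lt_trans xM (ltry _).
have x0 := Pilot.Defs.scale_norm_ge0 s q x.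
have xfin : scale_norm s q x \is a fin_num by rewrite ge0_fin_numE.
by exists (fine (scale_norm s q x)); rewrite fineK // -lee_fin fineK.
Qed.

Lemma majorizes_ge0 s u x n : majorizes s u x -> 0 <= u n.
Proof.
case: s => /= [xu|xu|xu].
- exact: le_trans (normc_ge0 _) (xu n).
- rewrite -(@pmulr_rge0 _ n.+1%:R) // (le_trans _ (xu n)) //.
  by apply: sumr_ge0 => i _; exact: normc_ge0.
- exact: le_trans (normc_ge0 _) (xu n n (leqnn n)).
Qed.

Lemma majorizesW s u v x : (forall n, u n <= v n) -> majorizes s u x ->
  majorizes s v x.
Proof.
move=> uv; case: s => /= xu n *.
- exact: le_trans (xu n) _.
- by apply: le_trans (xu n) _; rewrite ler_wpM2l.
- by apply: le_trans (uv n); exact: xu.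
Qed.

(** The factor [n + 1] comes from the [ces] scale, where [u n] bounds only the mean of the first
    [n + 1] moduli. *)
Lemma majorizes_coord s u x n : majorizes s u x -> normc (x n) <= n.+1%:R * u n.
Proof.
move=> xu; have u0 := majorizes_ge0 n xu.
case: s xu => /= xu.
- by apply: le_trans (xu n) _; rewrite ler_peMl // ler1n.
- apply: le_trans (xu n); rewrite big_ord_recr /= lerDr.
  by apply: sumr_ge0 => i _; exact: normc_ge0.
- by apply: le_trans (xu n n (leqnn n)) _; rewrite ler_peMl // ler1n.
Qed.

Lemma majorizes_ge s u x (c : R) n : majorizes s u x ->
  (forall n, c <= normc (x n)) -> c <= u n.
Proof.
case: s => /= xu xc.
- exact: le_trans (xc n) (xu n).
- rewrite -(@ler_pM2l _ n.+1%:R) // (le_trans _ (xu n)) //.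
  rewrite (@le_trans _ _ (\sum_(i < n.+1) c)) ?ler_sum //.
  by rewrite sumr_const card_ord mulr_natl.
- exact: le_trans (xc n) (xu n n (leqnn n)).
Qed.

(** For [ces], partial sums commute with [gconv]. For [d], moving from [n] to any [k >= n] costs at
    most the factor [(1 - tau)^-1]: the number [G = (1 - tau)^-1 * gconv tau u n] satisfies
    [G = gconv tau u n + tau * G], and [|x_k| <= u n <= gconv tau u n]. *)
Lemma majorizes_gconv s u x y tau (K : R) : 0 <= tau < 1 -> 0 <= K ->
  (forall n, normc (y n) <= K * gconv tau (fun i => normc (x i)) n) ->
  majorizes s u x ->
  majorizes s (fun n => K / (1 - tau) * gconv tau u n) y.
Proof.
move=> /andP[tau0 tau1] K0 yx xu; have d0 : 0 < 1 - tau by rewrite subr_gt0.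
have u0 n := majorizes_ge0 n xu.
have dV1 : 1 <= (1 - tau)^-1 by rewrite invf_ge1 // gerBl.
have g0 n : 0 <= gconv tau u n by exact: gconv_ge0.
case: s xu => /= xu n.
- apply: le_trans (yx n) _; rewrite -mulrA ler_wpM2l //.
  by rewrite (le_trans (le_gconv tau0 (fun i _ => xu i))) // ler_peMl.
- apply: (@le_trans _ _ (\sum_(i < n.+1) K * gconv tau (fun j => normc (x j)) i)).
    by apply: ler_sum => i _; exact: yx.
  rewrite -mulr_sumr sum_gconv mulrCA -!mulrA ler_wpM2l //.
  apply: (@le_trans _ _ (gconv tau (fun i => n.+1%:R * u i) n)).
    apply: le_gconv => // i ni; apply: le_trans (xu i) _.
    by rewrite ler_wpM2r // ler_nat ltnS.
  by rewrite gconvZ ler_peMl // mulr_ge0.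
- move=> k nk; apply: le_trans (yx k) _; rewrite -mulrA ler_wpM2l //.
  rewrite -(subnKC nk); elim: (k - n)%N => [|j ih].
    rewrite addn0 (@le_trans _ _ (gconv tau u n)) ?ler_peMl //.
    by apply: le_gconv => // i _; exact: xu.
  rewrite addnS gconvS (_ : (1 - tau)^-1 * _ =
      gconv tau u n + tau * ((1 - tau)^-1 * gconv tau u n)); last first.
    by field; rewrite gt_eqF.
  rewrite lerD ?ler_wpM2l // (le_trans (xu n _ _)) ?gconv_ge //.
  by rewrite -addnS leq_addr.
Qed.

(** One factor [(1 - tau)^-1] comes from [majorizes_gconv], the other from the l^q bound
    [gconv_power_sum]. *)
Lemma scale_norm_gconv s q x y tau (K M : R) : 1 <= q -> 0 <= tau < 1 ->
  0 <= K -> 0 <= M ->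
  (forall n, normc (y n) <= K * gconv tau (fun i => normc (x i)) n) ->
  (scale_norm s q x <= M%:E)%E ->
  (scale_norm s q y <= (K / (1 - tau) ^+ 2 * M)%:E)%E.
Proof.
move=> q1 tau01 K0 M0 yx; have q0 : 0 < q by exact: lt_le_trans q1.
have /andP[tau0 tau1] := tau01.
have d0 : 0 < 1 - tau by rewrite subr_gt0.
have c0 : 0 <= K / (1 - tau) by rewrite divr_ge0 // ltW.
move=> /(scale_norm_leP _ _ q0 M0) [u [xu uM]].
have u0 n := majorizes_ge0 n xu.
apply/scale_norm_leP => //; first by rewrite mulr_ge0 // divr_ge0 // exprn_ge0 // ltW.
exists (fun n => K / (1 - tau) * gconv tau u n); split; first exact: majorizes_gconv xu.
move=> N; under eq_bigr do rewrite powRM ?gconv_ge0 //.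
rewrite -mulr_sumr (_ : K / _ * M = K / (1 - tau) * ((1 - tau)^-1 * M)); last first.
  by field; rewrite gt_eqF.
rewrite [leRHS]powRM // ?mulr_ge0 ?invr_ge0 ?(ltW d0) //.
by rewrite ler_wpM2l ?powR_ge0 // gconv_power_sum.
Qed.

End ScaleNorms.

(** * Bounds for the Cesaro operator *)

Section CesaroBounds.
Context {R : realType}.
Implicit Types (q M t : R) (u : nat -> R) (x y : nat -> R[i]).

Lemma normc_sum n (f : 'I_n -> R[i]) : normc (\sum_i f i) <= \sum_i normc (f i).
Proof.
elim/big_ind2: _ => [|a r b r' ar br|//]; first by rewrite normc0.
exact: le_trans (le_normcD _ _) (lerD ar br).
Qed.

Lemma normcX (a : R[i]) n : normc (a ^+ n) = normc a ^+ n.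
Proof. by elim: n => [|n ih]; rewrite ?normc1 // !exprS normcM ih. Qed.

Lemma normc_gcesaro t x n : 0 <= t ->
  normc (gcesaro t%:C x n) <= gconv t (fun i => normc (x i)) n / n.+1%:R.
Proof.
move=> t0; rewrite /gcesaro normcM normcV normcn ler_wpM2r ?invr_ge0 //.
apply: le_trans (normc_sum _) _; apply: ler_sum => i _.
by rewrite normcM normcX normcR ger0_norm.
Qed.

Lemma normc_gcesaro_le t x n : 0 <= t ->
  normc (gcesaro t%:C x n) <= 1 * gconv t (fun i => normc (x i)) n.
Proof.
move=> t0; rewrite mul1r; apply: le_trans (normc_gcesaro _ _ t0) _.
rewrite ler_piMr ?invf_le1 ?ler1n ?gconv_ge0 // => i; exact: normc_ge0.
Qed.

(* Summation by parts. *)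
Lemma sum_div_le (a : nat -> R) (B : R) n :
  (forall i, \sum_(j < i.+1) a j <= B * i.+1%:R) ->
  \sum_(i < n.+1) a i / i.+1%:R <= B * \sum_(i < n.+1) i.+1%:R^-1.
Proof.
move=> aB; pose A i := \sum_(j < i.+1) a j.
(* Keeping the boundary term [A n / (n+1)] lets the induction close; in the end it is at most [B],
   the first term of [B] times the harmonic sum. *)
suff H : \sum_(i < n.+1) a i / i.+1%:R <=
    A n / n.+1%:R + B * (\sum_(i < n.+1) i.+1%:R^-1 - 1).
  apply: le_trans H _; rewrite -lerBrDr -mulrBr opprB addrCA subrr addr0 mulr1.
  by rewrite ler_pdivrMr // aB.
elim: n => [|n ih].
  by rewrite /A !big_ord1 invr1 subrr mulr0 addr0.
rewrite big_ord_recr /= (le_trans (lerD ih (lexx _))) //.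
rewrite [X in _ <= _ + _ * (X - _)]big_ord_recr /=.
have -> : a n.+1 = A n.+1 - A n by rewrite /A [in RHS]big_ord_recr /= addrAC subrr add0r.
rewrite -subr_ge0.
set S := \sum_(i < n.+1) _.
rewrite [X in 0 <= X](_ : _ = (B * n.+1%:R - A n) / (n.+1%:R * n.+2%:R)).
  by rewrite divr_ge0 // subr_ge0 aB.
rewrite -(natr1 n.+1); field.
by rewrite nat1r natr1 !pnatr_eq0.
Qed.

(** For [ell] and [d] the coordinates of [x] are at most 1 in modulus, so those of [C_t x] are at
    most [1/((1-t)(n+1))], which decreases in [n]. For [ces] only the partial sums of [gconv t |x|]
    are controlled, by [(i+1)/(1-t)], and summation by parts produces the harmonic sum. *)
Lemma majorizes_gcesaro s u x t : 0 <= t < 1 -> majorizes s u x ->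
  (forall n, u n <= 1) ->
  majorizes s (fun n => (1 - t)^-1 * harmonic_mean n) (gcesaro t%:C x).
Proof.
move=> /andP[t0 t1] xu u1; have d0 : 0 < 1 - t by rewrite subr_gt0.
have dV0 : 0 <= (1 - t)^-1 by rewrite invr_ge0 ltW.
have coord : (forall n, normc (x n) <= 1) -> forall n,
    normc (gcesaro t%:C x n) <= (1 - t)^-1 * n.+1%:R^-1.
  move=> x1 n; apply: le_trans (normc_gcesaro _ _ t0) _.
  rewrite ler_wpM2r ?invr_ge0 // (le_trans (le_gconv t0 (fun i _ => x1 i))) //.
  by rewrite (le_trans (gconv_cst_le _ _ _)) ?t0 // mul1r.
case: s xu => /= xu.
- move=> n; apply: le_trans (coord _ n) _; last by rewrite ler_wpM2l ?harmonic_mean_ge.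
  by move=> i; exact: le_trans (xu i) (u1 i).
- move=> n; rewrite /harmonic_mean mulrCA [X in _ <= _ * X]mulrC divfK ?pnatr_eq0 //.
  apply: le_trans (_ : _ <= \sum_(i < n.+1) gconv t (fun j => normc (x j)) i / i.+1%:R) _.
    by apply: ler_sum => i _; exact: normc_gcesaro.
  apply: sum_div_le => i; rewrite sum_gconv.
  apply: (@le_trans _ _ (gconv t (fun=> i.+1%:R) i)).
    apply: le_gconv => // j ji; apply: le_trans (xu j) _.
    by rewrite -[leRHS]mulr1 ler_pM ?(@majorizes_ge0 _ CesPlus u x) // ler_nat ltnS.
  by rewrite (le_trans (gconv_cst_le _ _ _)) ?t0 // mulrC.
- move=> n k nk; apply: le_trans (coord _ k) _.
    by move=> i; exact: le_trans (xu i i (leqnn i)) (u1 i).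
  rewrite ler_wpM2l // (le_trans _ (harmonic_mean_ge n)) //.
  by rewrite lef_pV2 ?posrE // ler_nat ltnS.
Qed.

Lemma majorizes_harmonic s x (A : R) : 0 <= A ->
  (forall n, normc (x n) <= A / n.+1%:R) ->
  majorizes s (fun n => A * harmonic_mean n) x.
Proof.
move=> A0 xA; case: s => /= n.
- by apply: le_trans (xA n) _; rewrite ler_wpM2l ?harmonic_mean_ge.
- rewrite /harmonic_mean mulrCA [X in _ <= _ * X]mulrC divfK ?pnatr_eq0 // mulr_sumr.
  by apply: ler_sum => i _; exact: xA.
- move=> k nk; apply: le_trans (xA k) _.
  rewrite ler_wpM2l // (le_trans _ (harmonic_mean_ge n)) //.
  by rewrite lef_pV2 ?posrE // ler_nat ltnS.
Qed.

Definition seqtail N x : nat -> R[i] := fun n => if (n < N)%N then 0 else x n.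

(** Freezing the majorant at [u N] below [N] is what the [d] scale asks for: there, the supremum
    from [n < N] onwards sees the whole tail. *)
Lemma majorizes_seqtail s u x N : majorizes s u x ->
  majorizes s (fun n => u (maxn N n)) (seqtail N x).
Proof.
move=> xu; have u0 n := majorizes_ge0 n xu.
case: s xu => /= xu n.
- rewrite /seqtail; case: ltnP => nN; first by rewrite normc0.
  exact: xu.
- case: (ltnP n N) => nN.
    rewrite big1 ?mulr_ge0 // => i _; rewrite /seqtail ifT ?normc0 //.
    by rewrite (leq_trans _ nN) // ltnS -ltnS.
  apply: le_trans (xu n).
  apply: ler_sum => i _; rewrite /seqtail; case: ifP => _ //.
  by rewrite normc0 normc_ge0.
- move=> k nk; rewrite /seqtail; case: ltnP => kN; first by rewrite normc0.
  by apply: xu; rewrite geq_max kN.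
Qed.

Lemma scale_norm_seqtail s q (c : R) : 1 < q -> 0 <= c -> forall e, 0 < e ->
  exists N, forall x, majorizes s (fun n => c * harmonic_mean n) x ->
    (scale_norm s q (seqtail N x) <= e%:E)%E.
Proof.
move=> q1 c0 e e0; have q0 : 0 < q by exact: lt_trans q1.
have [w [B [d [d0 B0 hw wB]]]] := harmonic_mean_tail q1.
have w0 n : 0 <= w n.
  have := hw 0%N n; rewrite powR1 mul1r; exact: le_trans (harmonic_mean_ge0 _).
(* [N] is taken so large that [c * B * (N+1)^(-d) <= e]; it depends only on the common majorant and
   not on [x]. *)
pose z := c * B / e; have z0 : 0 <= z by rewrite divr_ge0 ?mulr_ge0 // ltW.
pose N := Num.bound (z `^ d^-1); exists N => x xh.
have zN : z <= N.+1%:R `^ d.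
  have -> : z = (z `^ d^-1) `^ d by rewrite -powRrM mulVf ?powRr1 // gt_eqF.
  rewrite ge0_ler_powR ?nnegrE ?powR_ge0 ?(ltW d0) //.
  by rewrite (le_trans (ltW (archi_boundP (powR_ge0 _ _)))) // ler_nat.
have N0 : 0 < N.+1%:R `^ d by exact: powR_gt0.
apply/scale_norm_leP => //; first exact: ltW.
exists (fun n => c * N.+1%:R `^ (- d) * w n); split.
  apply: majorizesW (majorizes_seqtail N xh) => n.
  by rewrite -mulrA ler_wpM2l.
move=> L; under eq_bigr do rewrite powRM ?mulr_ge0 ?powR_ge0 //.
rewrite -mulr_sumr (le_trans (ler_wpM2l _ (wB L))) ?powR_ge0 //.
rewrite -powRM ?mulr_ge0 ?powR_ge0 //.
rewrite ge0_ler_powR ?nnegrE ?mulr_ge0 ?powR_ge0 ?(ltW q0) ?(ltW e0) //.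
by rewrite powRN mulrAC ler_pdivrMr // [e * _]mulrC -ler_pdivrMr.
Qed.

Lemma scale_norm_majorizes_harmonic s q (c : R) x : 1 < q -> 0 <= c ->
  majorizes s (fun n => c * harmonic_mean n) x -> (scale_norm s q x < +oo)%E.
Proof.
move=> q1 c0 xh; have q0 : 0 < q by exact: lt_trans q1.
have [w [B [d [d0 B0 hw wB]]]] := harmonic_mean_tail q1.
have hw0 n : harmonic_mean n <= w n by have := hw 0%N n; rewrite powR1 mul1r max0n.
apply/scale_norm_lty => //; exists (c * B); split; first exact: mulr_ge0.
apply/scale_norm_leP => //; first exact: mulr_ge0.
exists (fun n => c * w n); split.
  by apply: majorizesW xh => n; rewrite ler_wpM2l.
have w0 n : 0 <= w n by exact: le_trans (harmonic_mean_ge0 n) (hw0 n).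
move=> L; under eq_bigr do rewrite powRM //.
by rewrite -mulr_sumr powRM // ler_wpM2l ?powR_ge0.
Qed.

(** A majorant [u] in the [d] scale has [|x_n| <= u i] for every [i <= n]; adding these [n + 1]
    inequalities gives [(n+1) |x_n| <= M]. *)
Lemma d_norm1_decay x : (d_norm 1 x < +oo)%E ->
  exists A, 0 <= A /\ forall n, normc (x n) <= A / n.+1%:R.
Proof.
move=> /(@scale_norm_lty _ DPlus 1 x ltr01)[M [M0 /(scale_norm_leP _ _ ltr01 M0)]].
move=> [u [/= xu uM]]; exists M; split=> // n.
have u0 k := @majorizes_ge0 _ DPlus u x k xu.
rewrite ler_pdivlMr // mulr_natr -[leRHS]powRr1 // (le_trans _ (uM n.+1)) //.
under eq_bigr do rewrite powRr1 //.
rewrite -[X in _ *+ X]card_ord -sumr_const; apply: ler_sum => i _.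
by apply: xu; rewrite -ltnS.
Qed.

Lemma d_norm1_scale s q x : 1 < q -> (d_norm 1 x < +oo)%E ->
  (scale_norm s q x < +oo)%E.
Proof.
move=> q1 /d_norm1_decay[A [A0 xA]].
exact: scale_norm_majorizes_harmonic q1 A0 (majorizes_harmonic s A0 xA).
Qed.

Lemma scale_norm_pinfty s q (c : R) x : 0 < q -> 0 < c ->
  (forall n, c <= normc (x n)) -> ~ (scale_norm s q x < +oo)%E.
Proof.
move=> q0 c0 xc /(scale_norm_lty _ _ q0)[M [M0 /(scale_norm_leP _ _ q0 M0)]].
move=> [u [xu uM]]; have cu n := majorizes_ge n xu xc.
have cq : 0 < c `^ q by exact: powR_gt0.
pose N := Num.bound (M `^ q / c `^ q).
have := archi_boundP (divr_ge0 (powR_ge0 M q) (powR_ge0 c q)); rewrite -/N.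
rewrite ltr_pdivrMr // ltNge => /negP; apply; apply: le_trans (uM N).
rewrite mulr_natl -[X in _ *+ X]card_ord -sumr_const; apply: ler_sum => i _.
by rewrite ge0_ler_powR ?nnegrE ?(ltW c0) ?(ltW q0) ?(le_trans (ltW c0)).
Qed.

Lemma d_norm1_delta m : (d_norm 1 (fun n => (n == m)%:R : R[i]) < +oo)%E.
Proof.
apply/(@scale_norm_lty _ DPlus) => //; exists m.+1%:R; split => //.
apply/scale_norm_leP => //; exists (fun n => (n <= m)%:R); split.
  move=> n k nk /=; rewrite normcn ler_nat; case: eqP => [<-|//].
  by rewrite nk.
move=> N; rewrite powRr1 //; under eq_bigr do rewrite powRr1 //.
rewrite -natr_sum ler_nat.
suff : (\sum_(n < N) (n <= m) <= minn N m.+1)%N by rewrite leq_min => /andP[].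
elim: N => [|N]; first by rewrite big_ord0.
rewrite big_ord_recr /= !leq_min => /andP[sN sm].
case: (leqP N m) => Nm; rewrite ?addn1 ?addn0; last by rewrite sm leqW.
by rewrite !ltnS sN (leq_trans sN).
Qed.

End CesaroBounds.

(** * The triangular system *)

Section TriangularSolution.
Context {R : realType}.
Local Notation C := R[i].
Implicit Types (l t a : C) (x y : nat -> C).

Definition cconv t x n : C := \sum_(i < n.+1) t ^+ (n - i) * x i.

Lemma cconv0 t x : cconv t x 0 = x 0%N.
Proof. by rewrite /cconv big_ord1 mul1r. Qed.

Lemma cconvS t x n : cconv t x n.+1 = t * cconv t x n + x n.+1.
Proof.
rewrite /cconv big_ord_recr /= subnn mul1r mulr_sumr; congr (_ + _).
by apply: eq_bigr => i _; rewrite mulrA -exprS subSn // -ltnS.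
Qed.

Definition lambda_seq l t x : nat -> C := fun n => l * x n - gcesaro t x n.

(* In terms of [S_n := sum_(i <= n) t^(n-i) x_i], for which
   [x_n = S_n - t S_(n-1)], the equation [l x - C_t x = y] reads
   [(l - 1/(n+1)) S_n = l t S_(n-1) + y_n]; [resnum] is the right-hand side.
   When [l = 1/(m+1)] the convention [_ / 0 = 0] selects the solution with
   [S_m = 0], which exists if and only if [resnum l t y m = 0]. *)
Fixpoint resnum l t y n : C :=
  if n is k.+1 then l * t * (resnum l t y k / (l - k.+1%:R^-1)) + y k.+1
  else y 0%N.

Definition ressol l t y : nat -> C :=
  fun n => (y n + resnum l t y n / (l - n.+1%:R^-1) / n.+1%:R) / l.

(** Only the indices below [n] are restricted, so the case [l = 1/(n+1)] is included; there the
    right-hand side is 0, which is the necessary condition for solvability. *)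
Lemma resnum_lambda_seq l t x n : (forall k, (k < n)%N -> l != k.+1%:R^-1) ->
  resnum l t (lambda_seq l t x) n = (l - n.+1%:R^-1) * cconv t x n.
Proof.
elim: n => [|n ih] ln /=.
  by rewrite /lambda_seq /gcesaro big_ord1 cconv0 mul1r mulrBl invr1 mulr1 mul1r.
rewrite ih; last by move=> k kn; apply: ln; exact: ltnW.
rewrite [_ * cconv t x n]mulrC mulfK ?subr_eq0 ?ln // /lambda_seq.
rewrite -[gcesaro t x n.+1]/(cconv t x n.+1 / n.+2%:R) cconvS.
by ring.
Qed.

Lemma ressol_lambda_seq l t x : l != 0 -> (forall k, l != k.+1%:R^-1) ->
  ressol l t (lambda_seq l t x) = x.
Proof.
move=> l0 ln; apply/funext => n.
rewrite /ressol resnum_lambda_seq; last by move=> k _; exact: ln.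
rewrite [_ * cconv t x n]mulrC mulfK ?subr_eq0 ?ln //.
by rewrite /lambda_seq -[gcesaro t x n]/(cconv t x n / n.+1%:R) subrK mulrC mulKf.
Qed.

Lemma lambda_seq_ressol l t y : l != 0 ->
  (forall k, l = k.+1%:R^-1 -> resnum l t y k = 0) ->
  lambda_seq l t (ressol l t y) = y.
Proof.
move=> l0 ln; pose S n := resnum l t y n / (l - n.+1%:R^-1).
(* At an index with [l = 1/(n+1)] the quotient [S n] is 0 by convention, and the solvability
   condition makes both sides vanish. *)
have SE n : (l - n.+1%:R^-1) * S n = resnum l t y n.
  have [e|/eqP ne] := eqVneq l n.+1%:R^-1; first by rewrite /S ln // mul0r mulr0.
  by rewrite /S mulrC divfK // subr_eq0; apply/eqP.
have cS n : cconv t (ressol l t y) n = S n.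
  elim: n => [|n ih]; last rewrite cconvS ih.
    rewrite cconv0 /ressol -/(S _); apply: (mulIf l0); rewrite divfK //.
    have := SE 0%N; rewrite /= => <-.
    by rewrite invr1; ring.
  rewrite /ressol -/(S n.+1); apply: (mulIf l0); rewrite mulrDl divfK //.
  have := SE n.+1; rewrite /= -/(S n) => /eqP; rewrite mulrBl subr_eq => /eqP SS.
  by rewrite [RHS]mulrC SS; ring.
apply/funext => n; rewrite /lambda_seq.
rewrite -[gcesaro t _ n]/(cconv t (ressol l t y) n / n.+1%:R) cS.
by rewrite /ressol -/(S n) mulrC divfK // addrK.
Qed.

Lemma resnum_linear l t a x y n :
  resnum l t (a *: x + y) n = a * resnum l t x n + resnum l t y n.
Proof.
elim: n => [//|n ih] /=; rewrite ih.
rewrite -[(a *: x + y) n.+1]/(a * x n.+1 + y n.+1); ring.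
Qed.

Lemma ressol_linear l t a x y :
  ressol l t (a *: x + y) = a *: ressol l t x + ressol l t y.
Proof.
apply/funext => n; rewrite -[RHS]/(a * ressol l t x n + ressol l t y n).
rewrite /ressol resnum_linear -[(a *: x + y) n]/(a * x n + y n); ring.
Qed.

Lemma gcesaro_linear t a x y :
  gcesaro t (a *: x + y) = a *: gcesaro t x + gcesaro t y.
Proof.
apply/funext => n; rewrite -[RHS]/(a * gcesaro t x n + gcesaro t y n) /gcesaro.
rewrite mulrA mulr_sumr -mulrDl -big_split; congr (_ / _); apply: eq_bigr => i _ /=.
rewrite -[(a *: x + y) i]/(a * x i + y i); ring.
Qed.

(** At [n = m] this says that the functional cutting out the range takes the value 1 on the unit
    vector [e_m], which therefore spans a complement. *)
Lemma resnum_delta l t m n : (n <= m)%N ->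
  resnum l t (fun k => (k == m)%:R) n = (n == m)%:R.
Proof.
elim: n => [//|n ih] nm /=.
by rewrite ih ?(ltnW nm) // ltn_eqF // mul0r mulr0 add0r.
Qed.

(** By induction all [S_n] vanish: the equation at [n] forces [x n = 0] unless [l = 1/(n+1)], where
    the second hypothesis steps in. This covers [l = 0] as well as the uniqueness of
    eigenvectors. *)
Lemma lambda_seq_inj l t x : lambda_seq l t x = 0 ->
  (forall k, l = k.+1%:R^-1 -> x k = 0) -> x = 0.
Proof.
move=> lx0 lk; have E n : l * x n = cconv t x n / n.+1%:R.
  by apply/eqP; rewrite -subr_eq0 -[X in X == _]/(lambda_seq l t x n) lx0.
have S0 n : cconv t x n = 0.
  elim: n => [|n ih].
    rewrite cconv0; have := E 0%N; rewrite cconv0 invr1 mulr1.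
    have [e|ne] := eqVneq l 1; first by rewrite lk // e invr1.
    move=> /eqP; rewrite -subr_eq0 -[X in _ - X]mul1r -mulrBl mulf_eq0 subr_eq0.
    by rewrite (negbTE ne) => /eqP.
  have := E n.+1; rewrite cconvS ih mulr0 add0r.
  have [e|ne] := eqVneq l n.+2%:R^-1; first by rewrite lk.
  move=> /eqP; rewrite [_ / _]mulrC -subr_eq0 -mulrBl mulf_eq0 subr_eq0.
  by rewrite (negbTE ne) => /eqP.
apply/funext => -[|n]; first by have := S0 0%N; rewrite cconv0.
by have := S0 n.+1; rewrite cconvS S0 mulr0 add0r.
Qed.

(** Since [t^(n-i) t^(i-m) = t^(n-m)], this is the hockey-stick identity for ['C(i, m)], obtained
    from Pascal's rule. The truncated [n - m] is harmless because the binomial vanishes for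
    [n < m]. *)
Lemma cconv_eigenseq t m a n :
  cconv t (eigenseq t m a) n = a * ('C(n.+1, m.+1)%:R * t ^+ (n - m)).
Proof.
have E k : eigenseq t m a k = a * ('C(k, m)%:R * t ^+ (k - m)).
  by rewrite /eigenseq; case: ltnP => // km; rewrite bin_small // mul0r mulr0.
elim: n => [|n ih]; last rewrite cconvS ih.
  by rewrite cconv0 E; case: m {E} => [|m]; rewrite ?bin0n // !bin_small.
rewrite E [in RHS]binS natrD; have [nm|mn] := ltnP n m.
  by rewrite (@bin_small n.+1 m.+1) // !mul0r !mulr0 !add0r.
by rewrite subSn // exprS; ring.
Qed.

(** What remains is the absorption identity [(n+1) 'C(n, m) = (m+1) 'C(n+1, m+1)]. *)
Lemma lambda_seq_eigenseq t m a :
  lambda_seq m.+1%:R^-1 t (eigenseq t m a) = 0.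
Proof.
apply/funext => n; rewrite /lambda_seq.
rewrite -[gcesaro t _ n]/(cconv t (eigenseq t m a) n / n.+1%:R) cconv_eigenseq.
apply/eqP; rewrite subr_eq0; apply/eqP.
have -> : eigenseq t m a n = a * ('C(n, m)%:R * t ^+ (n - m)).
  by rewrite /eigenseq; case: ltnP => // nm; rewrite bin_small // mul0r mulr0.
apply: (@mulfI _ (n.+1%:R * m.+1%:R)); first by rewrite mulf_neq0 ?pnatr_eq0.
have H : n.+1%:R * 'C(n, m)%:R = m.+1%:R * 'C(n.+1, m.+1)%:R :> C.
  by rewrite -!natrM mul_bin_diag.
transitivity (a * t ^+ (n - m) * (n.+1%:R * 'C(n, m)%:R)).
  by field; rewrite nat1r pnatr_eq0.
by rewrite H; field; rewrite nat1r pnatr_eq0.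
Qed.

Lemma eigenseq_diag t m a : eigenseq t m a m = a.
Proof. by rewrite /eigenseq ltnn binn subnn mul1r mulr1. Qed.

End TriangularSolution.

(** * Locally uniform bounds for the solution operator, and decay of the eigenvectors *)

Section ResolventBounds.
Context {R : realType}.
Local Notation C := R[i].
Implicit Types (l a : C) (x y : nat -> C) (t d L : R).

Lemma le_normcB l a : normc l - normc a <= normc (l - a).
Proof. by rewrite lerBlDr -{1}(subrK a l) le_normcD. Qed.

(* The factors [l t / (l - 1/(n+1))] of the recursion tend to [t]: all but
   finitely many have modulus at most [tau := (1 + t) / 2], and the others are
   absorbed by the constant. *)
Lemma resnum_bound t d L : 0 <= t < 1 -> 0 < d -> exists K tau,
  [/\ 0 <= K, 0 <= tau < 1 &
    forall l, d <= normc l <= L ->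
      (forall n, l = n.+1%:R^-1 \/ d <= normc (l - n.+1%:R^-1)) ->
      forall y n, normc (resnum l t%:C y n) <= K * gconv tau (fun i => normc (y i)) n].
Proof.
move=> /andP[t0 t1] d0; pose tau := (1 + t) / 2.
have tau0 : 0 < tau by rewrite /tau; lra.
have tau1 : tau < 1 by rewrite /tau; lra.
have ttau : t < tau by rewrite /tau; lra.
(* If [1/(k+1) <= d * e], then [|l - 1/(k+1)| >= |l| (1 - e) = |l| t / tau], so the k-th factor is
   at most [tau]. The choice of [N] ensures this for [k >= N], and [tau * b] below bounds the
   remaining factors. *)
pose e := 1 - t / tau; have e0 : 0 < e by rewrite subr_gt0 ltr_pdivrMr // mul1r.
pose b := 1 + `|L| / (d * tau).
have b1 : 1 <= b by rewrite lerDl divr_ge0 // mulr_ge0 // ltW.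
have b0 : 0 <= b by exact: le_trans b1.
pose N := Num.bound (d * e)^-1.
exists (b ^+ N), tau; split; rewrite ?exprn_ge0 ?(ltW tau0) //.
move=> l /andP[dl lL] ln y n.
have l0 : 0 < normc l by exact: lt_le_trans dl.
have L0 : 0 <= L by exact: le_trans (ltW l0) lL.
pose kap k := normc l * t / normc (l - k.+1%:R^-1).
have kN k : (N <= k)%N -> kap k <= tau.
  move=> Nk; have [/eqP|lk] := eqVneq (normc (l - k.+1%:R^-1)) 0.
    by rewrite /kap => /eqP ->; rewrite invr0 mulr0 ltW.
  rewrite /kap ler_pdivrMr ?lt0r ?lk ?normc_ge0 //.
  have kde : k.+1%:R^-1 <= d * e.
    rewrite -[leRHS]invrK lef_pV2 ?posrE ?invr_gt0 ?mulr_gt0 //.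
    apply: le_trans (ltW (archi_boundP _)) _; first by rewrite invr_ge0 mulr_ge0 // ltW.
    by rewrite ler_nat (leq_trans Nk).
  have := le_normcB l k.+1%:R^-1; rewrite normcV normcn.
  have : d * e <= normc l * e by rewrite ler_wpM2r // ltW.
  move=> de nl; have {}nl : normc l * (t / tau) <= normc (l - k.+1%:R^-1).
    rewrite (_ : _ * _ = normc l - normc l * e); last by rewrite /e; ring.
    by apply: le_trans nl; rewrite lerD2l lerN2 (le_trans kde).
  apply: le_trans (ler_wpM2l (ltW tau0) nl).
  by rewrite mulrCA (mulrCA tau) mulfV ?gt_eqF // mulr1.
have kb k : kap k <= tau * b.
  have -> : tau * b = tau + `|L| / d by rewrite /b; field; rewrite !gt_eqF.
  have [/eqP|lk] := eqVneq (normc (l - k.+1%:R^-1)) 0.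
    rewrite /kap => /eqP ->; rewrite invr0 mulr0.
    by apply: addr_ge0; [exact: ltW | apply: divr_ge0 => //; exact: ltW].
  rewrite (@le_trans _ _ (`|L| / d)) ?lerDr ?(ltW tau0) // ger0_norm //.
  have dk : d <= normc (l - k.+1%:R^-1).
    by case: (ln k) => // e1; rewrite e1 subrr normc0 eqxx in lk.
  rewrite /kap ler_pM ?mulr_ge0 ?invr_ge0 ?normc_ge0 //.
    by rewrite -[L]mulr1 ler_pM ?normc_ge0 // ltW.
  by rewrite lef_pV2 // posrE (lt_le_trans d0).
pose g := gconv tau (fun i => normc (y i)).
have g0 k : 0 <= g k by apply: gconv_ge0 (ltW tau0) _ => i; exact: normc_ge0.
(* The exponent [minn n N] grows only while [n < N], so a factor [b] is paid at most [N] times. *)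
suff H : normc (resnum l t%:C y n) <= b ^+ minn n N * g n.
  by apply: le_trans H _; rewrite ler_wpM2r // ler_weXn2l // geq_minr.
elim: n => [|n ih]; first by rewrite min0n mul1r /g gconv0.
rewrite /= (le_trans (le_normcD _ _)) // /g gconvS -/g addrC mulrDr.
apply: lerD; first by rewrite ler_peMl ?normc_ge0 // exprn_ege1.
rewrite !normcM normcV normcR ger0_norm //.
rewrite (_ : _ * _ = kap n * normc (resnum l t%:C y n)); last by rewrite /kap; ring.
apply: le_trans (ler_wpM2l _ ih) _.
  by rewrite divr_ge0 ?mulr_ge0 ?normc_ge0.
suff H : kap n * b ^+ minn n N <= b ^+ minn n.+1 N * tau.
  by rewrite mulrA [leRHS]mulrA; apply: ler_wpM2r H.
case: (ltnP n N) => nN.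
  rewrite (minn_idPl nN) exprS [leRHS]mulrAC [b * tau]mulrC.
  by apply: ler_wpM2r (kb n); exact: exprn_ge0.
rewrite (minn_idPr (leqW nN)) [leRHS]mulrC.
by apply: ler_wpM2r (kN n nN); exact: exprn_ge0.
Qed.

Lemma ressol_bound t d L : 0 <= t < 1 -> 0 < d -> exists K tau,
  [/\ 0 <= K, 0 <= tau < 1 &
    forall l, d <= normc l <= L ->
      (forall n, l = n.+1%:R^-1 \/ d <= normc (l - n.+1%:R^-1)) ->
      forall y n, normc (ressol l t%:C y n) <= K * gconv tau (fun i => normc (y i)) n].
Proof.
move=> t01 d0; have [K [tau [K0 tau01 KP]]] := @resnum_bound t d L t01 d0.
have dV0 : 0 <= d^-1 by rewrite invr_ge0 ltW.
exists ((1 + K / d) / d), tau; split => //.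
  by rewrite mulr_ge0 // addr_ge0 // mulr_ge0.
move=> l lL ln y n; have /andP[tau0 tau1] := tau01; have /andP[dl _] := lL.
have l0 : 0 < normc l by exact: lt_le_trans dl.
pose g := gconv tau (fun i => normc (y i)) n.
have g0 : 0 <= g by apply: gconv_ge0 => // i; exact: normc_ge0.
rewrite /ressol normcM normcV -/g [leRHS]mulrAC.
apply: ler_pM; rewrite ?invr_ge0 ?normc_ge0 ?lef_pV2 //.
rewrite mulrDl mul1r (le_trans (le_normcD _ _)) // lerD //.
  by apply: (@gconv_ge _ tau (fun i => normc (y i)) n) => // i; exact: normc_ge0.
rewrite !normcM !normcV normcn.
apply: (@le_trans _ _ (normc (resnum l t%:C y n) / normc (l - n.+1%:R^-1))).
  by rewrite ler_piMr ?divr_ge0 ?normc_ge0 // invf_le1 // ler1n.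
rewrite [leRHS]mulrAC; apply: ler_pM; rewrite ?invr_ge0 ?normc_ge0 ?KP //.
case: (ln n) => [->|dn]; first by rewrite subrr normc0 invr0.
by rewrite lef_pV2 // posrE (lt_le_trans d0).
Qed.

(** For [t < r < 1] the bound ['C(n, m) r^(n-m) <= (1-r)^(-m)] gives [|x_n| <= K (t/r)^(n-m)]. The
    eigenvector is thus dominated by a geometric convolution of the unit vector [e_m]. *)
Lemma d_norm1_eigenseq t m a : 0 <= t < 1 ->
  (d_norm 1 (eigenseq t%:C m a) < +oo)%E.
Proof.
move=> /andP[t0 t1]; pose r := (1 + t) / 2.
have r0 : 0 < r by rewrite /r; lra.
have r1 : r < 1 by rewrite /r; lra.
have tr : t < r by rewrite /r; lra.
have tau01 : 0 <= t / r < 1.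
  by rewrite divr_ge0 ?(ltW r0) //= ltr_pdivrMr // mul1r.
have c0 : 0 < (1 - r) ^+ m by rewrite exprn_gt0 // subr_gt0.
pose K := normc a / (1 - r) ^+ m.
have K0 : 0 <= K by rewrite divr_ge0 ?normc_ge0 // ltW.
have /(@scale_norm_lty _ DPlus _ _ ltr01) [M [M0 dM]] := @d_norm1_delta R m.
apply/(@scale_norm_lty _ DPlus) => //.
exists (K / (1 - t / r) ^+ 2 * M); split.
  by rewrite mulr_ge0 // divr_ge0 // exprn_ge0 // subr_ge0 ltW ?(andP tau01).2.
apply: scale_norm_gconv dM => // n.
rewrite /eigenseq; case: ltnP => [nm|mn].
  rewrite normc0 mulr_ge0 // gconv_ge0 ?(andP tau01).1 // => i; exact: normc_ge0.
apply: (@le_trans _ _ (K * (t / r) ^+ (n - m))); last first.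
  rewrite ler_wpM2l // /gconv (bigD1 (inord m)) //= inordK // eqxx normcn mulr1.
  rewrite lerDl sumr_ge0 // => i _.
  by rewrite mulr_ge0 ?normc_ge0 // exprn_ge0 // (andP tau01).1.
rewrite !normcM normcn normcX normcR ger0_norm // /K -mulrA ler_wpM2l ?normc_ge0 //.
rewrite expr_div_n mulrA ler_pdivlMr ?exprn_gt0 // mulrAC -[leRHS]mulrC -[leRHS]mul1r.
rewrite [1 * _]mul1r mulrC.
(* [r ^ (n - m) (1 - r) ^ m 'C(n, m)] is a term of [(r + (1 - r)) ^ n = 1]. *)
have B : 'C(n, m)%:R * r ^+ (n - m) <= ((1 - r) ^+ m)^-1.
  rewrite -[leRHS]mul1r ler_pdivlMr //.
  have := exprDn r (1 - r) n; rewrite addrC subrK expr1n => E; rewrite [leRHS]E.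
  rewrite (bigD1 (inord m)) //= inordK // -mulrA mulr_natl lerDl sumr_ge0 // => i _.
  by rewrite mulrn_wge0 // mulr_ge0 ?exprn_ge0 ?(ltW r0) // subr_ge0 ltW.
by rewrite ler_wpM2r ?exprn_ge0.
Qed.

End ResolventBounds.

(** * Spaces defined by seminorms *)

Section FiniteSeminormSpaces.
Context {R : realType} (q : nat -> eseminorm R).
Local Notation C := R[i].
Local Notation X := (fspace q).
Implicit Types (x y z : X) (k j : nat) (e d : R).

Lemma fspace_ext x y : (forall n, fseq x n = fseq y n) -> x = y.
Proof. by move=> xy; apply: val_inj; apply/funext. Qed.

Lemma fsnB_sym k x y : fsn k (x - y) = fsn k (y - x).
Proof.
rewrite -[x - y]opprB -scaleN1r fsnZ.
by rewrite normcN normc1 mul1r.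
Qed.

Lemma fspace_lift (A : (nat -> C) -> nat -> C) :
  (forall a u v, A (a *: u + v) = a *: A u + A v) ->
  (forall u, u \in finite_esn q -> A u \in finite_esn q) ->
  exists T : {linear X -> X}, forall x, fseq (T x) = A (fseq x).
Proof.
move=> Alin Afin; pose T x : X := FSpace (Afin _ (valP x)).
have Tlin : linear T.
  by move=> a x y; apply: val_inj; exact: (Alin a (fseq x) (fseq y)).
pose Tl := GRing.isLinear.Build C X X *:%R T Tlin.
pose T' : {linear X -> X} := HB.pack T Tl.
by exists T'.
Qed.

(** Stated for a family [W], so that it yields continuity for a singleton and equicontinuity in
    general. *)
Lemma fsn_bounded_fball (W : set {linear X -> X}) :
  (forall k, exists M, forall S, W S -> forall x, fsn k (S x) <= M * fsn k x) ->
  forall k e, 0 < e -> exists2 d, 0 < d & forall S, W S -> forall x y,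
    fball x (k, d) y -> fball (S x) (k, e) (S y).
Proof.
move=> /choice[M MP] k e e0; pose L := \sum_(j < k.+1) `|M j| + 1.
have L0 : 0 < L by rewrite ltr_wpDl // sumr_ge0.
exists (e / L) => [|S WS x y xy j jk]; first by rewrite divr_gt0.
rewrite /= -linearB; apply: le_lt_trans (MP j S WS _) _.
apply: (@le_lt_trans _ _ (L * fsn j (y - x))).
  rewrite ler_wpM2r ?fsn_ge0 // /L (bigD1 (Ordinal (jk : (j < k.+1)%N))) //=.
  rewrite (le_trans (ler_norm _)) // -addrA lerDl addr_ge0 // sumr_ge0 //.
by rewrite mulrC -ltr_pdivlMr //; exact: xy.
Qed.

Lemma fsn_bounded_continuous (T : {linear X -> X}) :
  (forall k, exists M, forall x, fsn k (T x) <= M * fsn k x) -> continuous T.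
Proof.
move=> TM x U [[k e] /= e0 kU].
have [|d d0 dT] := @fsn_bounded_fball [set T] _ k e e0.
  by move=> j; have [M MP] := TM j; exists M => S ->.
by exists (k, d) => //= y xy; apply: kU; exact: dT.
Qed.

Lemma fsn_bounded_equicontinuous (W : set {linear X -> X}) :
  (forall k, exists M, forall S, W S -> forall x, fsn k (S x) <= M * fsn k x) ->
  equicontinuous W
    (fun S : {linear X -> X} => (S : X -> X) : X -> pointed_tvs (E := X)).
Proof.
move=> WM x E [U [[[k e] /= e0 kU] UE]].
have [d d0 dW] := fsn_bounded_fball WM k e0.
exists (k, d) => //= y xy S WS; apply/set_mem/UE/mem_set/kU => j jk /=.
by rewrite subr0 fsnB_sym; exact: dW.
Qed.

Hypothesis coord : forall n, exists M, forall x, normc (fseq x n) <= M * fsn 0 x.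

Lemma fsn_eq0 x : fsn 0 x = 0 -> x = 0.
Proof.
move=> x0; apply: fspace_ext => n; have [M /(_ x)] := coord n.
rewrite x0 mulr0 => xn; apply: eq0_normc; apply/eqP.
by rewrite eq_le xn normc_ge0.
Qed.

Lemma fspace_hausdorff : hausdorff_space X.
Proof.
move=> x y xy; apply/eqP; rewrite -subr_eq0; apply/eqP/fsn_eq0/eqP.
rewrite eq_le fsn_ge0 andbT leNgt; apply/negP => d0.
have e0 : 0 < fsn 0 (x - y) / 2 by rewrite divr_gt0.
have [||z [/(_ 0%N isT)/= xz /(_ 0%N isT)/= yz]] := xy (fball x (0%N, fsn 0 (x - y) / 2))
  (fball y (0%N, fsn 0 (x - y) / 2)).
- by eexists; [|exact: subset_refl].
- by eexists; [|exact: subset_refl].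
have := fsnD 0 (x - z) (z - y); rewrite subrKA (fsnB_sym 0 x z).
move: xz yz; lra.
Qed.

Lemma closed_fspace_kernel (phi : (nat -> C) -> C) (M : R) :
  (forall u v, phi (u - v) = phi u - phi v) ->
  (forall x : X, normc (phi (fseq x)) <= M * fsn 0 x) ->
  closed [set x : X | phi (fseq x) = 0].
Proof.
move=> phiB phiM x clx; apply: contrapT => /eqP px.
have p0 := normc_gt0 px.
pose L := `|M| + 1; have L0 : 0 < L by rewrite ltr_wpDl.
have [|y [/= y0 /(_ 0%N isT)/= yx]] := clx (fball x (0%N, normc (phi (fseq x)) / L)).
  by eexists; [|exact: subset_refl]; rewrite /= divr_gt0.
have := phiM (x - y); rewrite -[fseq _]/(fseq x - fseq y) phiB y0 subr0 fsnB_sym.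
rewrite ltr_pdivlMr // in yx; have M0 := ler_norm M.
rewrite leNgt => /negP; apply; apply: le_lt_trans yx; rewrite mulrC.
by rewrite ler_wpM2l ?fsn_ge0 // (le_trans M0) // lerDl.
Qed.

End FiniteSeminormSpaces.

(** * Compactness *)

Section Compactness.
Context {R : realType}.
Local Notation C := R[i].
Local Notation Z := (prod_topology (fun _ : nat * bool => R)).

(* Complex sequences are parametrized by their real and imaginary parts, so
   that Tychonoff's theorem is only needed for real segments. *)
Definition reim (z : Z) : nat -> C := fun n => z (n, true) +i* z (n, false).

Lemma Z_coord_continuous (i : nat * bool) : continuous (fun z : Z => z i).
Proof. exact: (@proj_continuous _ (fun=> R) i). Qed.

Lemma normc_reim_continuous (a : C) n : continuous (fun z : Z => normc (reim z n - a)).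
Proof.
case: a => a b z; rewrite /reim /=.
apply: (@continuous_comp _ _ _
    (fun z : Z => (z (n, true) - a) ^+ 2 + (z (n, false) - b) ^+ 2));
  last exact: sqrt_continuous.
apply: (@continuousD R _ _ (fun z : Z => (z (n, true) - a) ^+ 2)
    (fun z => (z (n, false) - b) ^+ 2));
  apply: (@continuous_comp _ _ _ (fun z : Z => z _ - _) (fun x => x ^+ 2));
  try exact: exprn_continuous.
  by apply: (@continuousB R _ _ _ (cst a));
    [exact: Z_coord_continuous|exact: cst_continuous].
by apply: (@continuousB R _ _ _ (cst b));
  [exact: Z_coord_continuous|exact: cst_continuous].
Qed.

Lemma normc_reim_continuous0 n : continuous (fun z : Z => normc (reim z n)).
Proof.
rewrite (_ : (fun z : Z => _) = fun z : Z => normc (reim z n - 0)).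
  exact: normc_reim_continuous.
by apply/funext => z; rewrite subr0.
Qed.

Lemma closed_continuous_le (f : Z -> R) (c : R) : continuous f ->
  closed [set z | f z <= c].
Proof.
move=> fc; apply: (@preimage_closed _ _ f [set x | x <= c]); last exact: closed_le.
by move=> z _; exact: fc.
Qed.

Lemma closed_majorizes s u : closed [set z | majorizes s u (reim z)].
Proof.
case: s.
- rewrite (_ : mkset _ = \bigcap_n [set z | normc (reim z n) <= u n]).
    by apply: closed_bigI => n _; exact/closed_continuous_le/normc_reim_continuous0.
  by apply/seteqP; split=> [z zu n _|z zu n]; [exact: zu|exact: (zu n I)].
- rewrite (_ : mkset _ = \bigcap_n
      [set z | \sum_(i < n.+1) normc (reim z i) <= n.+1%:R * u n]).
    apply: closed_bigI => n _; apply: closed_continuous_le.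
    apply: (@continuous_big R 'I_(n.+1) _ _ _ add_continuous) => i _.
    exact: normc_reim_continuous0.
  by apply/seteqP; split=> [z zu n _|z zu n]; [exact: zu|exact: (zu n I)].
- rewrite (_ : mkset _ = \bigcap_n \bigcap_(k in [set k | (n <= k)%N])
      [set z | normc (reim z k) <= u n]).
    apply: closed_bigI => n _; apply: closed_bigI => k _.
    exact/closed_continuous_le/normc_reim_continuous0.
  by apply/seteqP; split=> [z zu n _ k nk|z zu n k nk]; [exact: zu|exact: (zu n I)].
Qed.

(** Coordinates are split off one at a time: the tail from [N] is [d_N e_N] plus the tail from
    [N + 1]. *)
Lemma esn_seqtail_le (p : eseminorm R) (c : nat -> R) (d : nat -> C) N :
  (forall i, p (fun n => (n == i)%:R) = (c i)%:E) ->
  (p d <= (\sum_(i < N) normc (d i) * c i)%:E + p (seqtail N d))%E.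
Proof.
move=> pc; elim: N => [|N ih].
  by rewrite big_ord0 add0e (_ : seqtail 0 d = d) //; apply/funext.
apply: le_trans ih _; rewrite big_ord_recr EFinD -addeA leeD2l //.
rewrite EFinM -pc -esnZ; apply: le_trans (esnD _ _ _).
rewrite (_ : _ + _ = seqtail N d) //; apply/funext => n.
rewrite -[(_ + _) n]/(d N * (n == N)%:R + seqtail N.+1 d n) /seqtail ltnS.
by case: ltngtP => [nN|nN|->]; rewrite ?mulr0 ?mulr1 ?add0r ?addr0.
Qed.

Variable q : nat -> eseminorm R.
Local Notation X := (fspace q).

(* On a set with uniformly small tails the topology of the space coincides with
   the product topology. *)
Lemma precompact_tails (P : set (nat -> C)) (r : nat -> R) :
  (forall n, exists M, forall x : X, normc (fseq x n) <= M * fsn 0 x) ->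
  (forall k i, (q k (fun n => (n == i)%:R) < +oo)%E) ->
  closed [set z | P (reim z)] ->
  (forall x n, P x -> normc (x n) <= r n) ->
  (forall x, P x -> x \in finite_esn q) ->
  (forall k e, 0 < e -> exists N, forall x, P x -> (q k (seqtail N x) <= e%:E)%E) ->
  precompact [set x : X | P (fseq x)].
Proof.
move=> coord qdelta Pcl Pr Pfin Ptail.
pose box : set Z := [set z | forall i, `[- r i.1, r i.1]%classic (z i)].
have box_compact : compact box.
  apply: (@tychonoff _ (fun=> R) (fun i => `[- r i.1, r i.1]%classic)) => i.
  exact: segment_compact.
have Pbox : [set z | P (reim z)] `<=` box.
  move=> z Pz [n b] /=; rewrite in_itv /= -ler_norml.
  apply: le_trans (Pr _ n Pz); rewrite /reim /= -sqrtr_sqr ler_wsqrtr //.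
  by case: b; rewrite ?lerDl ?lerDr sqr_ge0.
have D_compact : compact [set z | P (reim z)].
  exact: subclosed_compact Pcl box_compact Pbox.
(* The default value 0 makes [f] total; [f] is only evaluated at [z] with [P (reim z)], where it is
   a genuine lift. *)
pose f (z : Z) : X := insubd 0 (reim z).
have fE z : P (reim z) -> fseq (f z) = reim z.
  by move=> Pz; rewrite -[fseq _]/(val (f z)) /f insubdK //; exact: Pfin.
apply: (@precompact_subset _ _ (f @` [set z | P (reim z)])).
  move=> x Px.
  pose z : Z :=
    fun i => if i.2 then complex.Re (fseq x i.1) else complex.Im (fseq x i.1).
  have zx : reim z = fseq x by apply/funext => n; rewrite /reim /z /=; case: (fseq x n).
  exists z; first by rewrite /= zx.
  by apply: val_inj; rewrite /= -[LHS]/(fseq (f z)) fE zx.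
apply: compact_precompact; first exact: fspace_hausdorff.
apply: continuous_compact D_compact; apply/subspace_continuousP => z Pz.
move=> U [[k e] /= e0 kU].
suff H (j : 'I_k.+1) :
    \forall y \near z, P (reim y) -> fsn j (f y - f z) < e.
  apply: filterS (@filter_forall Z _ _ (nbhs z) _ H) => y Hy Py; apply: kU => j jk.
  exact: (Hy (Ordinal (jk : (j < k.+1)%N))).
(* One quarter of [e] goes to the first [N] coordinates, which depend continuously on the product
   topology, and one to the tail of each of the two sequences. *)
have e4 : 0 < e / 4 by rewrite divr_gt0.
have [N NP] := Ptail j _ e4.
pose c i := fine (q j (fun n => (n == i)%:R)).
have cE i : q j (fun n => (n == i)%:R) = (c i)%:E.
  by rewrite fineK // ge0_fin_numE ?esn_ge0.
pose h (y : Z) := \sum_(i < N) normc (reim y i - reim z i) * c i.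
have hc : continuous h.
  apply: (@continuous_big R 'I_N _ _ _ add_continuous) => i _ y.
  apply: (@continuousM R _ (fun y : Z => normc (reim y i - reim z i)) (cst (c i))).
    exact: normc_reim_continuous.
  exact: cst_continuous.
have hz : h z < e / 4.
  by rewrite /h big1 // => i _; rewrite subrr normc0 mul0r.
have near_h : \forall y \near z, h y < e / 4 by exact: (cvgr_lt (h z) (hc z)).
apply: filterS near_h => y hy Py.
rewrite -lte_fin fsnE; apply: le_lt_trans (esn_seqtail_le _ N cE) _.
have dE n : \val (f y - f z) n = reim y n - reim z n.
  by rewrite -[LHS]/(fseq (f y) n - fseq (f z) n) !fE.
have tailE : seqtail N (\val (f y - f z)) =
    seqtail N (reim y) + (- 1) *: seqtail N (reim z).
  apply/funext => n; rewrite -[RHS]/(_ + -1 * _) /seqtail.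
  case: ifP => _; first by rewrite mulr0 addr0.
  by rewrite mulN1r dE.
have tail_le : (q j (seqtail N (\val (f y - f z)%R)) <= (e / 4 + e / 4)%:E)%E.
  rewrite tailE; apply: le_trans (esnD _ _ _) _.
  by rewrite esnZ normcN normc1 mul1e EFinD leeD // NP.
apply: (@le_lt_trans _ _ ((h y)%:E + (e / 4 + e / 4)%:E)%E).
  apply: leeD => //; rewrite lee_fin /h le_eqVlt; apply/orP; left; apply/eqP.
  by apply: eq_bigr => i _; rewrite dE.
by rewrite -EFinD lte_fin; move: hy; lra.
Qed.

End Compactness.

(** * The Frechet scales *)

Section FrechetScales.
Context {R : realType} (p : R) (p1 : 1 <= p) (pk : exponents p) (s : frechet_kind).
Local Notation C := R[i].
Local Notation X := (frechet s p1 pk).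
Implicit Types (x y : X) (u v : nat -> C) (K tau : R) (l : C).

Let qk k : eseminorm R := scale_esn s (le_trans p1 (ltW (expo_gt pk k))).

Let pk1 k : 1 < pk k. Proof. exact: le_lt_trans p1 (expo_gt pk k). Qed.

Lemma power_sum_coord_le (w : nat -> R) q M n : 0 < q -> 0 <= M ->
  (forall N, \sum_(n < N) w n `^ q <= M `^ q) -> 0 <= w n -> w n <= M.
Proof.
move=> q0 M0 wM w0; rewrite leNgt; apply/negP => Mw.
have := gt0_ltr_powR q0 M0 w0 Mw; rewrite ltNge => /negP; apply.
apply: le_trans (wM n.+1); rewrite big_ord_recr /= lerDr.
by apply: sumr_ge0 => i _; exact: powR_ge0.
Qed.

Lemma fsn_majorant k x : exists w, majorizes s w (fseq x) /\
  (forall n, w n <= fsn k x).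
Proof.
have q0 : 0 < pk k by exact: lt_trans (pk1 k).
have : (scale_norm s (pk k) (fseq x) <= (fsn k x)%:E)%E by rewrite fsnE.
move=> /(scale_norm_leP _ _ q0 (fsn_ge0 k x)) [w [xw wM]].
exists w; split=> // n; apply: power_sum_coord_le wM _ => //; first exact: fsn_ge0.
exact: majorizes_ge0 xw.
Qed.

Lemma frechet_coord n : exists M, forall x, normc (fseq x n) <= M * fsn 0 x.
Proof.
exists n.+1%:R => x; have [w [xw wM]] := fsn_majorant 0 x.
by apply: le_trans (majorizes_coord n xw) _; rewrite ler_wpM2l.
Qed.

Lemma d_norm1_frechet u : (d_norm 1 u < +oo)%E -> u \in finite_esn qk.
Proof. by move=> ud; apply/asboolP => k; exact: d_norm1_scale. Qed.

Lemma gconv_finite_esn u v K tau : 0 <= tau < 1 -> 0 <= K ->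
  (forall n, normc (v n) <= K * gconv tau (fun i => normc (u i)) n) ->
  u \in finite_esn qk -> v \in finite_esn qk.
Proof.
move=> tau01 K0 vu /asboolP uf; apply/asboolP => k.
have q0 : 0 < pk k by exact: lt_trans (pk1 k).
have /(scale_norm_lty _ _ q0) [M [M0 uM]] := uf k.
by apply: le_lt_trans (scale_norm_gconv (ltW (pk1 k)) tau01 K0 M0 vu uM) (ltry _).
Qed.

Lemma gconv_fsn_le k x y K tau : 0 <= tau < 1 -> 0 <= K ->
  (forall n, normc (fseq y n) <= K * gconv tau (fun i => normc (fseq x i)) n) ->
  fsn k y <= K / (1 - tau) ^+ 2 * fsn k x.
Proof.
move=> tau01 K0 yx; rewrite -lee_fin fsnE.
by apply: (scale_norm_gconv (ltW (pk1 k)) tau01 K0 (fsn_ge0 k x) yx); rewrite fsnE.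
Qed.

Lemma frechet_lift (A : (nat -> C) -> nat -> C) K tau :
  0 <= tau < 1 -> 0 <= K ->
  (forall a u v, A (a *: u + v) = a *: A u + A v) ->
  (forall u n, normc (A u n) <= K * gconv tau (fun i => normc (u i)) n) ->
  exists T : {linear X -> X}, (forall x, fseq (T x) = A (fseq x)) /\ continuous T.
Proof.
move=> tau01 K0 Alin AK.
have [|T TE] := @fspace_lift R qk A Alin.
  by move=> u; apply: gconv_finite_esn tau01 K0 _ => n; exact: AK.
exists T; split => //; apply: fsn_bounded_continuous => k.
exists (K / (1 - tau) ^+ 2) => x; apply: gconv_fsn_le => // n.
by rewrite TE; exact: AK.
Qed.

(** * Compactness, spectra, ranges and eigenspaces of the Cesaro operator on a fixed space *)

Variables (t : R) (t01 : 0 <= t < 1) (T : {linear X -> X}).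
Hypothesis TE : forall x, fseq (T x) = gcesaro t%:C (fseq x).

Lemma fseq_lambda_sub l x : fseq (lambda_sub l T x) = lambda_seq l t%:C (fseq x).
Proof.
by apply/funext => n; rewrite /lambda_seq -TE.
Qed.

Lemma frechet_delta m : exists x : X, forall n, fseq x n = (n == m)%:R.
Proof. by exists (FSpace (d_norm1_frechet (d_norm1_delta m))). Qed.

Lemma gcesaro_compact_operator : compact_operator T.
Proof.
exists (fball (0 : X) (0%N, 1)); first by exists (0%N, 1) => //=.
pose w n := (1 - t)^-1 * harmonic_mean n.
have c0 : 0 <= (1 - t)^-1 by rewrite invr_ge0 subr_ge0 ltW // (andP t01).2.
apply: (@precompact_subset _ _ [set x : X | majorizes s w (fseq x)]).
  move=> _ [x x1 <-]; rewrite /= TE.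
  have [u [xu ux]] := fsn_majorant 0 x; apply: majorizes_gcesaro t01 xu _ => n.
  have := x1 0%N isT; rewrite /= subr0 => /ltW; exact: le_trans (ux n).
apply: (@precompact_tails R qk (majorizes s w) (fun n => n.+1%:R * w n)).
- exact: frechet_coord.
- move=> k i; apply: d_norm1_scale (pk1 k) _; exact: d_norm1_delta.
- exact: closed_majorizes.
- by move=> u n; exact: majorizes_coord.
- move=> u uw; apply/asboolP => k; exact: scale_norm_majorizes_harmonic (pk1 k) c0 uw.
- by move=> k e e0; exact: scale_norm_seqtail (pk1 k) c0 e e0.
Qed.

Lemma lambda_subB l x y :
  lambda_sub l T (x - y) = lambda_sub l T x - lambda_sub l T y.
Proof. by rewrite /lambda_sub scalerBr linearB opprD addrACA -opprD. Qed.

Lemma lambda_sub_eq l x y : lambda_sub l T x = lambda_sub l T y ->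
  (forall k, l = k.+1%:R^-1 -> fseq x k = fseq y k) -> x = y.
Proof.
move=> xy lk; apply/eqP; rewrite -subr_eq0; apply/eqP/val_inj.
apply: (@lambda_seq_inj _ l t%:C) => [|k /lk xyk].
  by rewrite -fseq_lambda_sub lambda_subB xy subrr.
by rewrite -[LHS]/(fseq x k - fseq y k) xyk subrr.
Qed.

Lemma lambda_sub_inj l : (forall k, l <> k.+1%:R^-1) -> injective (lambda_sub l T).
Proof. by move=> lk x y xy; apply: (lambda_sub_eq xy) => k /lk. Qed.

Lemma eigenvector_exists m (a : C) : exists2 x : X, fseq x = eigenseq t%:C m a &
  lambda_sub m.+1%:R^-1 T x = 0.
Proof.
exists (FSpace (d_norm1_frechet (d_norm1_eigenseq m a t01))) => //.
by apply: val_inj; rewrite -[LHS]/(fseq _) fseq_lambda_sub lambda_seq_eigenseq.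
Qed.

Lemma eigenvector_unique m x y : lambda_sub m.+1%:R^-1 T x = 0 ->
  lambda_sub m.+1%:R^-1 T y = 0 -> fseq x m = fseq y m -> x = y.
Proof.
move=> x0 y0 xy; apply: (@lambda_sub_eq m.+1%:R^-1); first by rewrite x0 y0.
by move=> k /invr_inj/eqP; rewrite eqr_nat eqSS => /eqP <-.
Qed.

Lemma point_spectrum_gcesaro : point_spectrum T = [set n.+1%:R^-1 | n in [set: nat]].
Proof.
apply/seteqP; split=> [l linj|_ [m _ <-] minj].
  apply: contrapT => lk; apply: linj; apply: lambda_sub_inj => k lE.
  by apply: lk; exists k.
have [x xE x0] := eigenvector_exists m 1.
have : lambda_sub m.+1%:R^-1 T x = lambda_sub m.+1%:R^-1 T 0.
  by rewrite x0 /lambda_sub scaler0 raddf0 subrr.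
move=> /minj xz; have := congr1 (fun y : X => fseq y m) xz.
by rewrite xE eigenseq_diag => /eqP; rewrite oner_eq0.
Qed.

Lemma resolvent_fseq l S x : l != 0 -> (forall k, l != k.+1%:R^-1) ->
  is_resolvent T l S -> fseq (S x) = ressol l t%:C (fseq x).
Proof.
move=> l0 lk [_ _ SK]; rewrite -{2}(SK x) fseq_lambda_sub.
by rewrite ressol_lambda_seq.
Qed.

(** As [1/(n+1)] tends to 0, all but finitely many of these points are at distance at least [|l|/2]
    from [l]; the others contribute a finite minimum. *)
Lemma spectral_gap l : l != 0 -> exists2 d : R, 0 < d &
  d <= normc l /\ forall n, l = n.+1%:R^-1 \/ d <= normc (l - n.+1%:R^-1).
Proof.
move=> l0; have nl := normc_gt0 l0.
pose N := Num.bound (normc l / 2)^-1.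
have [d d0 dN] : exists2 d : R, 0 < d &
    forall n, (n < N)%N -> l = n.+1%:R^-1 \/ d <= normc (l - n.+1%:R^-1).
  elim: N => [|N [d d0 dN]]; first by exists 1.
  have [lN|lN] := eqVneq l N.+1%:R^-1.
    exists d => // n; rewrite ltnS leq_eqVlt => /predU1P[->|]; [by left|exact: dN].
  exists (Num.min d (normc (l - N.+1%:R^-1))).
    by rewrite lt_min d0 normc_gt0 // subr_eq0.
  move=> n; rewrite ltnS leq_eqVlt => /predU1P[->|/dN[|dn]]; [right|by left|right].
    by rewrite ge_min lexx orbT.
  by rewrite ge_min dn.
have l2 : 0 < normc l / 2 by rewrite divr_gt0.
exists (Num.min d (normc l / 2)); first by rewrite lt_min d0.
split.
  by rewrite ge_min ler_pdivrMr // ler_peMr ?ler1n ?normc_ge0 // orbT.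
move=> n; rewrite ge_min; case: (ltnP n N) => [/dN[|dn]|nN]; [by left|right|right].
  by rewrite dn.
apply/orP; right; apply: le_trans (le_normcB _ _); rewrite normcV normcn.
rewrite lerBrDr [leRHS]splitr lerD2l.
rewrite -[leRHS]invrK lef_pV2 ?posrE ?invr_gt0 //.
apply: le_trans (ltW (archi_boundP _)) _; first by rewrite invr_ge0 ltW.
by rewrite ler_nat (leq_trans nN).
Qed.

(** If [l] has gap [d], every point of the disc of radius [d/2] has gap [d/2]. The constants of
    [ressol_bound] are then common to the whole disc, whence equicontinuity of the resolvents. *)
Lemma star_resolvent_gcesaro l : l != 0 -> (forall k, l != k.+1%:R^-1) ->
  star_resolvent_set T l.
Proof.
move=> l0 lk; have [d d0 [dl dk']] := spectral_gap l0.
have dk n : d <= normc (l - n.+1%:R^-1).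
  by case: (dk' n) => // lE; have := lk n; rewrite lE eqxx.
have e0 : 0 < d / 2 by rewrite divr_gt0.
have [K [tau [K0 tau01 KP]]] := @ressol_bound R t (d / 2) (normc l + d / 2) t01 e0.
have near_l (m : C) : `|m - l| < (d / 2)%:C -> [/\ d / 2 <= normc m <= normc l + d / 2,
    (forall n, d / 2 <= normc (m - n.+1%:R^-1)), m != 0 & forall k, m != k.+1%:R^-1].
  rewrite Pilot.Defs.normcE ltcR => ml.
  have far (c : C) : d <= normc (l - c) -> d / 2 <= normc (m - c).
    move=> dc; have := le_normcD (l - m) (m - c).
    by rewrite addrA subrK -[normc (l - m)]normcN opprB; lra.
  have dm : d / 2 <= normc m by rewrite -[m]subr0 far // subr0.
  split=> [|||k]; last 2 first.
  - by apply: contraTneq dm => ->; rewrite normc0 -ltNge.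
  - by have := far _ (dk k); apply: contraTneq => ->; rewrite subrr normc0 -ltNge.
  - rewrite dm /= -{1}(subrK l m) (le_trans (le_normcD _ _)) //.
    by rewrite addrC lerD2l ltW.
  - by move=> n; exact: far.
have bound (m : C) : `|m - l| < (d / 2)%:C -> forall u n,
    normc (ressol m t%:C u n) <= K * gconv tau (fun i => normc (u i)) n.
  by move=> /near_l[ml mk _ _] u n; apply: KP => // k; right.
exists (d / 2)%:C; first by rewrite ltcR.
split=> [m ml|].
  have [_ _ m0 mk] := near_l m ml.
  have [S [SE Sc]] := frechet_lift tau01 K0 (ressol_linear m t%:C) (bound m ml).
  exists S; split=> // x; apply: val_inj; rewrite -[LHS]/(fseq _).
    by rewrite SE fseq_lambda_sub ressol_lambda_seq.
  rewrite fseq_lambda_sub SE lambda_seq_ressol // => k mE.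
  by have := mk k; rewrite mE eqxx.
apply: (@fsn_bounded_equicontinuous R qk) => k.
exists (K / (1 - tau) ^+ 2) => S [m ml mS] x; apply: gconv_fsn_le => // n.
have [_ _ m0 mk] := near_l m ml.
by rewrite (resolvent_fseq x m0 mk mS) bound.
Qed.

(** Solving [- C_t x = (1/(n+1))_n] forces [S_n = -1] for all [n], hence
    [x_n = S_n - t S_(n-1) = -(1 - t)] for [n >= 1]. Such an [x] stays away from 0 and has infinite
    norm. *)
Lemma zero_in_spectrum : spectrum T 0.
Proof.
move=> [S [_ _ SK]].
have hfin : (fun n => n.+1%:R^-1 : C) \in finite_esn qk.
  apply/asboolP => k.
  have q0 : 0 < pk k by exact: lt_trans (pk1 k).
  apply: (@scale_norm_majorizes_harmonic R s (pk k) 1) => //.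
  by apply: majorizes_harmonic => // n; rewrite mul1r normcV normcn.
pose h : X := FSpace hfin; pose x := S h.
have xh n : cconv t%:C (fseq x) n = -1.
  have := congr1 (fun y : X => fseq y n) (SK h); rewrite fseq_lambda_sub.
  rewrite /lambda_seq mul0r sub0r -[gcesaro _ _ n]/(cconv t%:C (fseq x) n / n.+1%:R).
  move=> /= /(congr1 (fun z => - z * n.+1%:R)).
  by rewrite opprK divfK ?pnatr_eq0 // mulNr mulVf ?pnatr_eq0.
have xc n : 1 - t <= normc (fseq x n).
  case: n => [|n].
    by have := xh 0%N; rewrite cconv0 => ->; rewrite normcN normc1 gerBl; have /andP[] := t01.
  have := xh n.+1; rewrite cconvS xh => /(canRL (addKr _)) ->.
  rewrite (_ : _ + _ = - (1 - t)%:C); last by rewrite rmorphB rmorph1; ring.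
  by rewrite normcN normcR ler_norm.
have d0 : 0 < 1 - t by rewrite subr_gt0 (andP t01).2.
apply: (scale_norm_pinfty (lt_trans ltr01 (pk1 0)) d0 xc (s := s)).
by have /asboolP := valP x; exact.
Qed.

Lemma resolvent_setP l : resolvent_set T l -> l != 0 /\ forall k, l != k.+1%:R^-1.
Proof.
move=> lT; split=> [|k]; apply/eqP => lE.
  by apply: zero_in_spectrum; rewrite -lE.
have : point_spectrum T l by rewrite point_spectrum_gcesaro; exists k.
by apply; have [S [_ SK _]] := lT; exact: can_inj SK.
Qed.

Lemma star_spectrum_gcesaro : star_spectrum T = spectrum T.
Proof.
congr (~` _); apply/seteqP; split=> l.
  by move=> [d d0 [dT _]]; apply: dT; rewrite /= subrr normr0.
by move=> /resolvent_setP[]; exact: star_resolvent_gcesaro.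
Qed.

Lemma spectrum_gcesaro :
  spectrum T = [set n.+1%:R^-1 | n in [set: nat]] `|` [set 0].
Proof.
apply/seteqP; split=> [l lT|l lL /resolvent_setP[l0 lk]].
  apply: contrapT => lL; apply: lT.
  suff [d d0 [dT _]] : star_resolvent_set T l by apply: dT; rewrite /= subrr normr0.
  apply: star_resolvent_gcesaro => [|k]; apply/eqP => lE; apply: lL.
    by right.
  by left; exists k.
by case: lL => [[k _ lE]|/= lE]; [have := lk k; rewrite -lE eqxx|rewrite lE eqxx in l0].
Qed.

(** For the inclusion from right to left, [ressol] gives a preimage; it lies in the space because
    the gap of [l = 1/(m+1)] allows the index [m] itself as an exception. *)
Lemma range_lambda_sub m : range (lambda_sub m.+1%:R^-1 T) =
  [set y : X | resnum m.+1%:R^-1 t%:C (fseq y) m = 0].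
Proof.
pose l : C := m.+1%:R^-1; have l0 : l != 0 by rewrite invr_eq0 pnatr_eq0.
have lP k : l = k.+1%:R^-1 -> k = m.
  by move=> /invr_inj/eqP; rewrite eqr_nat eqSS => /eqP.
apply/seteqP; split=> [_ [x _ <-]|y /= y0].
  change (resnum l t%:C (fseq (lambda_sub l T x)) m = 0).
  rewrite fseq_lambda_sub resnum_lambda_seq ?subrr ?mul0r // => k km.
  by apply: contraTneq km => /lP ->; rewrite ltnn.
have [d d0 [dl dk]] := spectral_gap l0.
have [K [tau [K0 tau01 KP]]] := @ressol_bound R t d (normc l) t01 d0.
have [|S [SE _]] := frechet_lift tau01 K0 (ressol_linear l t%:C) _.
  by apply: KP => //; rewrite dl lexx.
exists (S y) => //; apply: val_inj; rewrite -[LHS]/(fseq _) fseq_lambda_sub SE.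
by rewrite lambda_seq_ressol // => k /lP ->.
Qed.

(** The range is the kernel of a functional of the coordinates up to [m], each of which is
    controlled by the seminorm [fsn 0]. *)
Lemma closed_range_lambda_sub m : closed (range (lambda_sub m.+1%:R^-1 T)).
Proof.
pose l : C := m.+1%:R^-1; have l0 : l != 0 by rewrite invr_eq0 pnatr_eq0.
have [d d0 [dl dk]] := spectral_gap l0.
have [K [tau [K0 /andP[tau0 _] KP]]] := @resnum_bound R t d (normc l) t01 d0.
have [M xM] := choice frechet_coord.
rewrite range_lambda_sub.
apply: (@closed_fspace_kernel R qk (fun u => resnum l t%:C u m) (K * gconv tau M m)).
  move=> u v; rewrite (_ : u - v = -1 *: v + u) ?resnum_linear ?mulN1r 1?addrC //.
  by rewrite scaleN1r addrC.
move=> x; apply: le_trans (KP l _ dk (fseq x) m) _; first by rewrite dl lexx.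
rewrite -mulrA ler_wpM2l // mulrC -gconvZ; apply: le_gconv => // i _.
by rewrite mulrC; exact: xM.
Qed.

Lemma codim_range_lambda_sub m : has_codim (range (lambda_sub m.+1%:R^-1 T)) 1.
Proof.
have [e eE] := frechet_delta m; exists (fun=> e) => x.
have resE (c : 'I_1 -> C) : range (lambda_sub m.+1%:R^-1 T) (x - \sum_i c i *: e) <->
    c ord0 = resnum m.+1%:R^-1 t%:C (fseq x) m.
  rewrite range_lambda_sub.
  change (resnum m.+1%:R^-1 t%:C (fseq (x - \sum_i c i *: e)) m = 0 <->
    c ord0 = resnum m.+1%:R^-1 t%:C (fseq x) m).
  rewrite big_ord1.
  rewrite (_ : fseq (x - _) = (- c ord0) *: fseq e + fseq x); last first.
    by rewrite scaleNr addrC.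
  have -> : fseq e = (fun n => (n == m)%:R) by apply/funext.
  rewrite resnum_linear resnum_delta // eqxx mulr1 addrC.
  by split=> [/eqP|->]; rewrite ?subrr // subr_eq0 => /eqP.
exists (fun=> resnum m.+1%:R^-1 t%:C (fseq x) m); split; first exact/resE.
by move=> c /resE cE; apply/funext => i; rewrite ord1 cE.
Qed.

Lemma eigenspace_linspan m (a : C) x : a != 0 -> fseq x = eigenseq t%:C m a ->
  [set y | lambda_sub m.+1%:R^-1 T y = 0] = linspan x.
Proof.
move=> a0 xE; have x0 : lambda_sub m.+1%:R^-1 T x = 0.
  by apply: val_inj; rewrite -[LHS]/(fseq _) fseq_lambda_sub xE lambda_seq_eigenseq.
have xm : fseq x m = a by rewrite xE eigenseq_diag.
have scale0 c : lambda_sub m.+1%:R^-1 T (c *: x) = 0.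
  by rewrite /lambda_sub [T _]linearZ scalerA mulrC -scalerA -scalerBr
    -/(lambda_sub _ T x) x0 scaler0.
apply/seteqP; split=> [y /= y0|_ [c _ <-]]; last exact: scale0.
(* This scalar makes the m-th coordinates agree, and an eigenvector is determined by that
   coordinate. *)
exists (fseq y m / a) => //; apply: (eigenvector_unique (scale0 _) y0).
by rewrite -[LHS]/(fseq y m / a * fseq x m) xm divfK.
Qed.

Lemma dim_eigenspace m : has_dim [set y | lambda_sub m.+1%:R^-1 T y = 0] 1.
Proof.
have [x xE x0] := eigenvector_exists m 1.
exists (fun=> x); split => // y; rewrite (eigenspace_linspan (oner_neq0 _) xE).
move=> [c _ <-]; exists (fun=> c); split; first by rewrite big_ord1.
move=> c' cc'; apply/funext => i; have := congr1 (fun z : X => fseq z m) cc'.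
rewrite big_ord1 -[fseq (c *: x) m]/(c * fseq x m).
rewrite -[fseq (c' ord0 *: x) m]/(c' ord0 * fseq x m) xE eigenseq_diag !mulr1.
by rewrite (ord1 i).
Qed.

End FrechetScales.

Theorem theorem4p5 (R : realType) (t : R) (t01 : 0 <= t < 1)
    (p : R) (p1 : 1 <= p) (pk : exponents p) (s : frechet_kind) :
  exists T : {linear frechet s p1 pk -> frechet s p1 pk},
    (forall x, fseq (T x) = gcesaro t%:C (fseq x)) /\
    let Lambda : set R[i] := [set n.+1%:R^-1 | n in [set: nat]] in
    [/\ continuous T /\ compact_operator T,
        [/\ point_spectrum T = Lambda,
            star_spectrum T = spectrum T &
            spectrum T = Lambda `|` [set 0]],
        (forall l : R[i], point_spectrum T l ->
          closed (range (lambda_sub l T)) /\ has_codim (range (lambda_sub l T)) 1) &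
        (forall (m : nat) (a : R[i]), a != 0 ->
          let xm := eigenseq t%:C m a in
          let eigenspace := [set x | lambda_sub (m.+1%:R^-1) T x = 0] in
          [/\ has_dim eigenspace 1,
              (d_norm 1 xm < +oo)%E,
              [set x : nat -> R[i] | (d_norm 1 x < +oo)%E] `<=`
                range (fun x : frechet s p1 pk => fseq x) &
              exists2 x : frechet s p1 pk,
                fseq x = xm & eigenspace = linspan x])].
Proof.
have t0 : 0 <= t by have /andP[] := t01.
have [T [TE Tc]] := @frechet_lift R p p1 pk s (gcesaro t%:C) 1 t t01 ler01
  (gcesaro_linear t%:C) (fun u n => normc_gcesaro_le u n t0).
exists T; split=> // Lambda; split.
- by split; [exact: Tc|exact: (gcesaro_compact_operator t01 TE)].
- split; [exact: (point_spectrum_gcesaro t01 TE)|exact: (star_spectrum_gcesaro t01 TE)|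
    exact: (spectrum_gcesaro t01 TE)].
- move=> l; rewrite (point_spectrum_gcesaro t01 TE) => -[m _ <-].
  split; first exact: (closed_range_lambda_sub t01 TE).
  exact: (codim_range_lambda_sub t01 TE).
- move=> m a a0 xm eigenspace; split.
  + exact: (dim_eigenspace t01 TE).
  + exact: d_norm1_eigenseq.
  + by move=> u ud; exists (FSpace (d_norm1_frechet p1 pk s ud)).
  + have [x xE _] := eigenvector_exists t01 TE m a.
    by exists x => //; exact: (eigenspace_linspan TE a0 xE).
Qed.
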